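(* Let $S\subset\mathbb{Z}^d$ be a finite set symmetric about the origin, $\mathcal{P}=\{P_\alpha\}_{\alpha\in S}$ a resolution of unity on $\mathbb{C}^D$, $\mu\in\mathbb{C}^D$ a unit vector, and $C_\mu\phi=2\langle\phi,\mu\rangle\mu-\phi$. Assume $\|P_\alpha\mu\|=\|P_{-\alpha}\mu\|$ for all $\alpha\in S$. Define, for $z\in T^d\setminus E$, $$w_o(z)=\frac{\mu-\eta(z)\mu}{\|\mu-\eta(z)\mu\|}=\Big(\sum_{\alpha\in S}\frac{\|P_\alpha\mu\|^2}{|1+z^\alpha|^2}\Big)^{-1/2}\sum_{\alpha\in S}\frac{z^\alpha}{1+z^\alpha}P_\alpha\mu ,$$ regarded as an element of $L^2(T^d,\mathbb{C}^D)$, and let $w=\mathcal{F}^{-1}w_o\in\ell^2(\mathbb{Z}^d,\mathbb{C}^D)$. Then the eigenspace of $U(S,\mathcal{P},C_\mu)$ for the eigenvalue $1$ equals $\{f\ast w: f\in\ell^2(\mathbb{Z}^d)\}$, where $(f\ast w)(x)=\sum_{y\in\mathbb{Z}^d}f(x-y)w(y)$.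
   Context: A resolution of unity: orthogonal projections $P_\alpha$ on $\mathbb{C}^D$, $P_\alpha P_\beta=0$ ($\alpha\neq\beta$), $\sum_\alpha P_\alpha=I$. $(\tau^\alpha f)(x)=f(x-\alpha)$ on $\ell^2(\mathbb{Z}^d,\mathbb{C}^D)$, $U(S,\mathcal{P},C)=\big(\sum_{\alpha\in S}\tau^\alpha P_\alpha\big)C$ with $C$ acting pointwise. Inner products are linear in the first argument. $T^d=\{z\in\mathbb{C}^d:|z_j|=1\}$ with normalized Haar measure $\nu$, $z^\alpha=\prod z_j^{\alpha_j}$. $E=\bigcup_{\alpha\in S}\{z:z^\alpha=-1\}$ (with $z^0=1$, so $\alpha=0$ contributes nothing) and $\eta(z)=\sum_{\alpha\in S}\frac{1-z^\alpha}{1+z^\alpha}P_\alpha$. The Fourier transform $\mathcal{F}:\ell^2(\mathbb{Z}^d,\mathbb{C}^D)\to L^2(T^d,\mathbb{C}^D)$ is $(\mathcal{F}f)(z)=\sum_x f(x)z^x$, with inverse $(\mathcal{F}^{-1}g)(x)=\int_{T^d}z^{-x}g(z)\,d\nu(z)$. $\ell^2(\mathbb{Z}^d)$ is the space of square-summable complex functions on $\mathbb{Z}^d$. *)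

(* Defs.v *)
From HB Require Import structures.
From mathcomp Require Import all_boot all_order all_algebra.
From mathcomp Require Import all_classical all_reals all_analysis.
From mathcomp Require Import complex.

Set Implicit Arguments.
Unset Strict Implicit.
Unset Printing Implicit Defensive.

Import Order.TTheory GRing.Theory Num.Theory.
Import numFieldNormedType.Exports.

Local Open Scope classical_set_scope.
Local Open Scope ring_scope.

Section Defs.
Variable R : realType.
Local Notation C := (R[i]).

Definition cnorm2 (z : C) : R := complex.Re z ^+ 2 + complex.Im z ^+ 2.

Variables (d D : nat).

Definition vnorm2 (v : 'cV[C]_D) : R := \sum_(i < D) cnorm2 (v i 0).
Definition vnorm (v : 'cV[C]_D) : R := Num.sqrt (vnorm2 v).

Definition cinner (u v : 'cV[C]_D) : C := \sum_(i < D) u i 0 * conjc (v i 0).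

Definition adjoint (M : 'M[C]_D) : 'M[C]_D := (map_mx conjc M)^T.

Definition resolution_of_unity (S : seq 'rV[int]_d)
    (P : 'rV[int]_d -> 'M[C]_D) : Prop :=
  [/\ (forall a, a \in S -> adjoint (P a) = P a /\ P a *m P a = P a),
      (forall a b, a \in S -> b \in S -> a != b -> P a *m P b = 0) &
      \sum_(a <- S) P a = 1%:M].

Definition Cmu (mu : 'cV[C]_D) (phi : 'cV[C]_D) : 'cV[C]_D :=
  (2 * cinner phi mu) *: mu - phi.

Definition Uop (S : seq 'rV[int]_d) (P : 'rV[int]_d -> 'M[C]_D)
    (Cop : 'cV[C]_D -> 'cV[C]_D) (f : 'rV[int]_d -> 'cV[C]_D) :
    'rV[int]_d -> 'cV[C]_D :=
  fun x => \sum_(a <- S) P a *m Cop (f (x - a)).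

Definition zpow (z : 'rV[C]_d) (a : 'rV[int]_d) : C :=
  \prod_(j < d) (z 0 j) ^ (a 0 j).

Definition in_E (S : seq 'rV[int]_d) (z : 'rV[C]_d) : bool :=
  has (fun a => zpow z a == -1) S.

Definition eta_op (S : seq 'rV[int]_d) (P : 'rV[int]_d -> 'M[C]_D)
    (z : 'rV[C]_d) : 'M[C]_D :=
  \sum_(a <- S) ((1 - zpow z a) / (1 + zpow z a)) *: P a.

(** w_o(z) = (mu - eta_op(z) mu)/||mu - eta_op(z) mu|| off E (set to 0 on the
    null set E) *)
Definition wo (S : seq 'rV[int]_d) (P : 'rV[int]_d -> 'M[C]_D)
    (mu : 'cV[C]_D) (z : 'rV[C]_d) : 'cV[C]_D :=
  if in_E S z then 0
  else let v := mu - eta_op S P z *m mu in (Complex (vnorm v)^-1 0) *: v.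

Definition torus_pt (th : nat -> R) : 'rV[C]_d :=
  \row_(j < d) (Complex (cos (2 * pi * th j)) (sin (2 * pi * th j))).

Fixpoint itint (n : nat) (g : (nat -> R) -> R) : R :=
  match n with
  | 0 => g (fun _ => 0)
  | m.+1 => \int[@lebesgue_measure R]_(t in `[0%R, 1%R]%classic)
             itint m (fun th => g (fun k => if k == m then t else th k))
  end.

(** integral over T^d against normalized Haar measure nu *)
Definition torus_int (g : 'rV[C]_d -> C) : C :=
  Complex (itint d (fun th => complex.Re (g (torus_pt th))))
          (itint d (fun th => complex.Im (g (torus_pt th)))).

Definition invFourier (g : 'rV[C]_d -> 'cV[C]_D) : 'rV[int]_d -> 'cV[C]_D :=
  fun x => \col_(i < D) torus_int (fun z => zpow z (- x) * g z i 0).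

End Defs.

(** sum of an (absolutely summable) real family over a countable type *)
Definition rsum (R : realType) (T : choiceType) (h : T -> R) : R :=
  fine (\esum_(x in [set: T]) (Num.max (h x) 0)%:E)
  - fine (\esum_(x in [set: T]) (Num.max (- h x) 0)%:E).

Definition csum (R : realType) (T : choiceType) (g : T -> R[i]) : R[i] :=
  Complex (rsum (fun x => complex.Re (g x))) (rsum (fun x => complex.Im (g x))).

Definition l2s (R : realType) (d : nat) (f : 'rV[int]_d -> R[i]) : Prop :=
  (\esum_(x in [set: 'rV[int]_d]) (cnorm2 (f x))%:E < +oo)%E.

Definition l2v (R : realType) (d D : nat) (g : 'rV[int]_d -> 'cV[R[i]]_D)
  : Prop :=
  (\esum_(x in [set: 'rV[int]_d]) (vnorm2 (g x))%:E < +oo)%E.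

Definition convolution (R : realType) (d D : nat) (f : 'rV[int]_d -> R[i])
    (w : 'rV[int]_d -> 'cV[R[i]]_D) : 'rV[int]_d -> 'cV[R[i]]_D :=
  fun x => \col_(i < D) csum (fun y => f (x - y) * w y i 0).

(* Main.v *)
(* Idea.  After Fourier transform the eigenvalue equation reads v = W(z) C v with
   W(z) the sum of the z^a P_a; off E its solution space is the line spanned by
   the unit vector w_o(z), so the eigenspace is the range of the pointwise
   projection w_o w_o^*, i.e. f = w^* conv g recovers g as f conv w.

   No L^2 space on the torus is needed: all symbols that occur (in particular
   w_o) are bounded pointwise limits of trigonometric polynomials, and such a
   symbol phi defines an operator M_phi on l^2(Z^d), the convolution with its
   Fourier coefficients.
   Bessel's inequality gives boundedness, dominated convergence gives Parseval
   for these symbols, hence phi |-> M_phi is multiplicative, and identities in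
   l^2 follow from identities that hold at EVERY point of the torus.

   E is never shown to be negligible.  With Q = prod_(a in S) (1 + z^a), the
   identity Q^2 (1 - w_o w_o^* ) = Q (1 - w_o w_o^* ) A (1 - W C), A = sum of the
   (Q / (1 + z^a)) P_a, holds everywhere (both sides vanish on E), so that
   M_(Q^2) kills g - f conv w when g is an eigenvector; and M_Q is injective
   because a square-summable h with h(x) = - h(x - a) for all x vanishes. *)

Require Import Defs.
From HB Require Import structures.
From mathcomp Require Import all_boot all_order all_algebra.
From mathcomp Require Import all_classical all_reals all_analysis.
From mathcomp Require Import complex.
From mathcomp Require Import measurable_realfun ring lra.

Set Implicit Arguments.
Unset Strict Implicit.
Unset Printing Implicit Defensive.

Import Order.TTheory GRing.Theory Num.Theory.
Import numFieldNormedType.Exports.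

Local Open Scope classical_set_scope.
Local Open Scope ring_scope.

(** * Iterated integrals over the unit cube *)

Section IteratedIntegral.
Variable R : realType.
Local Notation mu := (@lebesgue_measure R).
Local Notation I01 := (`[0%R, 1%R]%classic : set R).
Implicit Types (g h : (nat -> R) -> R) (n m : nat) (B : R).

(** By conversion, [itint m.+1 g] is the integral over [t] of [itint m (slice m t g)], so the
    outermost integral runs over the last coordinate. *)
Definition slice m (t : R) g : (nat -> R) -> R :=
  fun th => g (fun k => if k == m then t else th k).

(** Measurability tailored to [itint]: at each level it concerns only the partial integral as a
    function of the one variable integrated next. Closure properties then follow by induction on [n]
    from integration on the unit interval. *)
Fixpoint tame n g : Prop :=
  match n with
  | 0 => True
  | m.+1 => (forall t, tame m (slice m t g)) /\
            measurable_fun I01 (fun t => itint m (slice m t g))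
  end.

Lemma unit_itv_measure : mu I01 = 1%E.
Proof. by rewrite lebesgue_measure_itv/= lte_fin ltr01 oppr0 adde0. Qed.

Lemma unit_integrable (f : R -> R) B :
  measurable_fun I01 f -> (forall t, `|f t| <= B) ->
  mu.-integrable I01 (EFin \o f).
Proof.
move=> mf fB; apply: measurable_bounded_integrable => //.
  by rewrite [X in (X < _)%E]unit_itv_measure ltry.
exists B; split; first exact: num_real.
by move=> x Bx t _ /=; apply: le_trans (fB t) (ltW Bx).
Qed.

Lemma Rintegral_unit_cst (c : R) : \int[mu]_(t in I01) c = c.
Proof.
rewrite Rintegral_cst// [X in fine X](_ : _ = 1%E) ?mulr1//.
exact: unit_itv_measure.
Qed.

Lemma itint_norm_le n g B :
  tame n g -> (forall th, `|g th| <= B) -> `|itint n g| <= B.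
Proof.
elim: n g => [|n IH] g /=; first by move=> _; apply.
move=> [tg mg] gB.
have sB t : `|itint n (slice n t g)| <= B.
  by apply: IH => // th; exact: gB.
have ig := unit_integrable mg sB.
apply: le_trans (le_normr_Rintegral _ ig) _ => //.
rewrite -[leRHS]Rintegral_unit_cst; apply: le_Rintegral => //.
- apply: (@unit_integrable _ B); last by move=> t; rewrite normr_id.
  exact: measurableT_comp.
- apply: (@unit_integrable _ `|B|); last by move=> t.
  exact: measurable_cst.
Qed.

(** Tameness and the value of the integral are proved together: measurability of the outer integrand
    of the sum rests on additivity one level below. *)
Lemma tameD n g h B : tame n g -> tame n h ->
  (forall th, `|g th| <= B) -> (forall th, `|h th| <= B) ->
  tame n (fun th => g th + h th) /\
  itint n (fun th => g th + h th) = itint n g + itint n h.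
Proof.
elim: n g h => [|n IH] g h //= [tg mg] [th mh] gB hB.
have H t := IH _ _ (tg t) (th t) (fun _ => gB _) (fun _ => hB _).
have HE : (fun t => itint n (slice n t (fun th => g th + h th))) =
  (fun t => itint n (slice n t g) + itint n (slice n t h)).
  by apply/funext => t; exact: (H t).2.
split.
  split; first by move=> t; exact: (H t).1.
  by rewrite HE; exact: measurable_funD.
transitivity (\int[mu]_(t in I01) (itint n (slice n t g) + itint n (slice n t h))).
  by apply: eq_Rintegral => t _; exact: (H t).2.
apply: RintegralD => //; apply: (@unit_integrable _ B) => // t.
  by apply: itint_norm_le (tg t) _ => th'; exact: gB.
by apply: itint_norm_le (th t) _ => th'; exact: hB.
Qed.

Lemma tameZ n g B (c : R) : tame n g -> (forall th, `|g th| <= B) ->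
  tame n (fun th => c * g th) /\
  itint n (fun th => c * g th) = c * itint n g.
Proof.
elim: n g => [|n IH] g //= [tg mg] gB.
have H t := IH _ (tg t) (fun _ => gB _).
have HE : (fun t => itint n (slice n t (fun th => c * g th))) =
  (fun t => c * itint n (slice n t g)).
  by apply/funext => t; exact: (H t).2.
split.
  split; first by move=> t; exact: (H t).1.
  by rewrite HE; apply: measurable_funM => //; exact: measurable_cst.
transitivity (\int[mu]_(t in I01) (c * itint n (slice n t g))).
  by apply: eq_Rintegral => t _; exact: (H t).2.
apply: RintegralZl => //; apply: (@unit_integrable _ B) => // t.
by apply: itint_norm_le (tg t) _ => th'; exact: gB.
Qed.

(** Dominated convergence, one variable at a time: by induction the partial integrals converge
    pointwise and stay bounded by [B], so their limit is measurable and the outer integrals converge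
    as well. *)
Lemma tame_lim n (u : nat -> (nat -> R) -> R) g B :
  (forall k, tame n (u k)) -> (forall k th, `|u k th| <= B) ->
  (forall th, u k th @[k --> \oo] --> g th) ->
  tame n g /\ itint n (u k) @[k --> \oo] --> itint n g.
Proof.
elim: n u g => [|n IH] u g //= tu uB ug.
have H t := IH _ _ (fun k => (tu k).1 t) (fun k _ => uB k _) (fun _ => ug _).
have mg : measurable_fun I01 (fun t => itint n (slice n t g)).
  by apply: (measurable_fun_cvg (fun k => (tu k).2)) => t _; exact: (H t).2.
split; first by split => // t; exact: (H t).1.
have sB k t : `|itint n (slice n t (u k))| <= B.
  by apply: itint_norm_le ((tu k).1 t) _ => th'; exact: uB.
have mI01 : measurable (I01 : set (measurableTypeR R)) by [].
have mu_ k : measurable_fun I01 (fun t => (itint n (slice n t (u k)))%:E).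
  by apply/measurable_EFinP; exact: (tu k).2.
have mgE : measurable_fun I01 (fun t => (itint n (slice n t g))%:E).
  exact/measurable_EFinP.
have iB : mu.-integrable I01 (EFin \o (fun=> B : R)).
  by apply: (@unit_integrable (fun=> B) `|B|) => //; exact: measurable_cst.
have cE t : I01 t -> (itint n (slice n t (u k)))%:E @[k --> \oo] -->
    (itint n (slice n t g))%:E.
  by move=> _; apply: cvg_EFin; [exact: nearW|exact: (H t).2].
have [ig _ cI] := dominated_convergence mI01 mu_ mgE
  (aeW mu cE) iB
  (aeW mu (fun t k _ => sB k t)).
apply: fine_cvg; rewrite /Rintegral fineK; first exact: cI.
exact: integrable_fin_num.
Qed.

Lemma itint_le n g h B : tame n g -> tame n h ->
  (forall th, `|g th| <= B) -> (forall th, `|h th| <= B) ->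
  (forall th, g th <= h th) -> itint n g <= itint n h.
Proof.
elim: n g h => [|n IH] g h //= [tg mg] [th mh] gB hB gh.
apply: le_Rintegral => //.
- apply: (@unit_integrable _ B) => // t.
  by apply: itint_norm_le (tg t) _ => th'; exact: gB.
- apply: (@unit_integrable _ B) => // t.
  by apply: itint_norm_le (th t) _ => th'; exact: hB.
- by move=> t _; apply: (IH _ _ (tg t) (th t)) => th'; [exact: gB|exact: hB|exact: gh].
Qed.

End IteratedIntegral.

(** * Characters of the torus and their orthogonality relations *)

Section Characters.
Variable R : realType.
Local Notation C := R[i].
Local Notation mu := (@lebesgue_measure R).
Local Notation I01 := (`[0%R, 1%R]%classic : set R).
Local Notation Re := (@complex.Re _).
Local Notation Im := (@complex.Im _).

Lemma ReD (x y : C) : Re (x + y) = Re x + Re y. Proof. by case: x y => ? ? []. Qed.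
Lemma ImD (x y : C) : Im (x + y) = Im x + Im y. Proof. by case: x y => ? ? []. Qed.
Lemma ReN (x : C) : Re (- x) = - Re x. Proof. by case: x. Qed.
Lemma ImN (x : C) : Im (- x) = - Im x. Proof. by case: x. Qed.
Lemma ReM (x y : C) : Re (x * y) = Re x * Re y - Im x * Im y.
Proof. by case: x y => ? ? []. Qed.
Lemma ImM (x y : C) : Im (x * y) = Re x * Im y + Im x * Re y.
Proof. by case: x y => ? ? []. Qed.
Lemma complexP (x y : C) : Re x = Re y -> Im x = Im y -> x = y.
Proof. by case: x y => ? ? [] ? ? /= -> ->. Qed.

Definition cis (x : R) : C := Complex (cos x) (sin x).

Lemma cisD x y : cis (x + y) = cis x * cis y.
Proof.
by apply: complexP; rewrite ?ReM ?ImM /= ?cosD ?sinD// addrC mulrC addrC; ring.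
Qed.

Lemma cis0 : cis 0 = 1. Proof. by rewrite /cis cos0 sin0. Qed.

Lemma cisX x (a : int) : cis x ^ a = cis (a%:~R * x).
Proof.
have nat_case n : cis x ^+ n = cis (n%:R * x).
  elim: n => [|n IH]; first by rewrite mul0r cis0.
  by rewrite exprS IH -cisD -natr1 mulrDl mul1r addrC.
case: a => n; first exact: nat_case.
rewrite NegzE -exprnN nat_case; apply: (@mulfI _ (cis (n.+1%:R * x))).
  apply/eqP => /(congr1 (fun z => z * cis (- (n.+1%:R * x)))).
  by rewrite -cisD subrr cis0 mul0r => /eqP; rewrite oner_eq0.
have /eqP/divff : cis (n.+1%:R * x) <> 0.
  move=> /(congr1 (fun z => z * cis (- (n.+1%:R * x)))).
  by rewrite -cisD subrr cis0 mul0r => /eqP; rewrite oner_eq0.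
by rewrite /= => ->; rewrite -cisD mulrNz mulNr subrr cis0.
Qed.

Lemma cis_2pi (a : int) : cis (2 * pi * a%:~R) = 1.
Proof.
rewrite mulrC -cisX /cis mulrC mulr_natr cos2pi sin2pi.
exact: exp1rz.
Qed.

(** The arbitrary factor [c] covers real and imaginary parts at once, since [Im] is [Re] after
    multiplication by [-i]. *)
Lemma unit_integral_cis (c : C) (a : int) :
  measurable_fun I01 (fun t => Re (c * cis (2 * pi * a%:~R * t))) /\
  \int[mu]_(t in I01) Re (c * cis (2 * pi * a%:~R * t)) =
    Re (c * (a == 0)%:R).
Proof.
set w : R := 2 * pi * a%:~R.
pose f (t : R) : R := Re c * cos (w * t) - Im c * sin (w * t).
have fE : (fun t => Re (c * cis (w * t))) = f.
  by apply/funext => t; rewrite ReM.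
have df (t : R) : is_derive t 1 f (- w * (Re c * sin (w * t) + Im c * cos (w * t))).
  apply: is_derive_eq; rewrite ?scaler0 ?scale0r ?addr0 ?add0r /GRing.scale /=.
  by ring.
have cf : continuous f.
  move=> t; apply: differentiable_continuous; apply/derivable1_diffP.
  exact: ex_derive.
split.
  rewrite fE; apply: measurable_funTS; exact: continuous_measurable_fun.
rewrite (_ : (fun t => _) = f)//.
have [a0|a0] := eqVneq a 0.
  rewrite mulr1 -[RHS]Rintegral_unit_cst; apply: eq_Rintegral => t _.
  by rewrite /f /w a0 mulr0 mul0r cos0 sin0 mulr1 mulr0 subr0.
rewrite mulr0 /=.
have w0 : w != 0.
  by rewrite /w !mulf_neq0// ?pnatr_eq0 ?intr_eq0// gt_eqF// pi_gt0.
(* An antiderivative of [f]. It takes the same value at 0 and 1, because [w] is an integer multiple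
   of [2 * pi]. *)
pose F (t : R) : R := w^-1 * (Re c * sin (w * t) + Im c * cos (w * t)).
have dF (t : R) : is_derive t 1 F (f t).
  apply: is_derive_eq; rewrite /f ?scaler0 ?scale0r ?addr0 ?add0r /GRing.scale /=.
  by field.
have cF : continuous F.
  move=> t; apply: differentiable_continuous; apply/derivable1_diffP.
  exact: ex_derive.
have := @continuous_FTC2 R f F 0 1 ltr01 (continuous_subspaceT cf).
rewrite /Rintegral => ->.
- rewrite /F mulr0 mulr1 cos0 sin0.
  have := cis_2pi a; rewrite -/w => -[-> ->].
  by rewrite -EFinB /= subrr.
- split; first by move=> x _; exact: ex_derive.
  + by apply: cvg_at_right_filter; exact: cF.
  + by apply: cvg_at_left_filter; exact: cF.
- by move=> x _; rewrite derive1E; exact: derive_val.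
Qed.

(** In the induction [c] absorbs the factor of the coordinate that the slice freezes. *)
Lemma itint_cis n (c : C) (a : nat -> int) :
  let u := fun th : nat -> R =>
    Re (c * \prod_(k < n) cis (2 * pi * (a k)%:~R * th k)) in
  tame n u /\ itint n u = Re (c * \prod_(k < n) (a k == 0)%:R).
Proof.
elim: n c => [|n IH] c /=; first by rewrite !big_ord0.
set u := fun th => _.
have sE t : slice n t u = fun th => Re (c * cis (2 * pi * (a n)%:~R * t) *
    \prod_(k < n) cis (2 * pi * (a k)%:~R * th k)).
  apply/funext => th; rewrite /slice /u big_ord_recr /= eqxx.
  rewrite [_ * cis _]mulrC mulrA; congr (Re (_ * _)).
  by apply: eq_bigr => k _; rewrite ltn_eqF.
have iE t : itint n (slice n t u) = Re (c * \prod_(k < n) (a k == 0)%:R *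
    cis (2 * pi * (a n)%:~R * t)).
  by rewrite sE (IH _).2 mulrAC.
have [mi vi] := unit_integral_cis (c * \prod_(k < n) (a k == 0)%:R) (a n).
split; first split.
- by move=> t; rewrite sE; exact: (IH _).1.
- by rewrite (funext iE).
- rewrite big_ord_recr /= mulrA -vi; apply: eq_Rintegral => t _; exact: iE.
Qed.

End Characters.

(** * Baire functions on the torus and their Fourier coefficients *)

Section ComplexSquares.
Variable R : realType.
Local Notation C := R[i].
Local Notation Re := (@complex.Re _).
Local Notation Im := (@complex.Im _).
Implicit Types (x y : C).

Lemma cnorm2_ge0 x : 0 <= cnorm2 x. Proof. by rewrite addr_ge0// sqr_ge0. Qed.

Lemma cnorm20 : cnorm2 0 = 0 :> R. Proof. by rewrite /cnorm2 /= expr0n addr0. Qed.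

Lemma cnorm2_eq0 x : (cnorm2 x == 0) = (x == 0).
Proof.
by rewrite /cnorm2 paddr_eq0 ?sqr_ge0// !sqrf_eq0 eq_complex.
Qed.

Lemma cnorm2M x y : cnorm2 (x * y) = cnorm2 x * cnorm2 y.
Proof. by rewrite /cnorm2 ReM ImM; ring. Qed.

Lemma cnorm2N x : cnorm2 (- x) = cnorm2 x.
Proof. by rewrite /cnorm2 ReN ImN !sqrrN. Qed.

Lemma cnorm2J x : cnorm2 (conjc x) = cnorm2 x.
Proof. by case: x => a b; rewrite /cnorm2 /= sqrrN. Qed.

Lemma cnorm2D_le x y : cnorm2 (x + y) <= 2 * (cnorm2 x + cnorm2 y).
Proof.
rewrite /cnorm2 ReD ImD.
have := sqr_ge0 (Re x - Re y); have := sqr_ge0 (Im x - Im y).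
rewrite !expr2; nra.
Qed.

Lemma mulcJE x : x * conjc x = (cnorm2 x)%:C%C.
Proof. by case: x => a b; apply: complexP; rewrite ?ReM ?ImM /cnorm2 /=; ring. Qed.

Lemma sqr_Re_le x : (Re x) ^+ 2 <= cnorm2 x.
Proof. by rewrite lerDl sqr_ge0. Qed.

(** The crude bound [|t| <= t^2 + 1] turns bounds on [cnorm2] into bounds on real parts without
    square roots. *)
Lemma norm_Re_le x : `|Re x| <= cnorm2 x + 1.
Proof.
apply: le_trans (_ : (Re x) ^+ 2 + 1 <= _); last by rewrite lerD2r sqr_Re_le.
rewrite -[Re x ^+ 2]real_normK ?num_real//.
have := sqr_ge0 (`|Re x| - 1); rewrite expr2; nra.
Qed.

Lemma ImE x : Im x = Re (Complex 0 (-1) * x).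
Proof. by rewrite ReM /=; ring. Qed.


Lemma cis_conj t : conjc (cis t) = cis (- t) :> C.
Proof. by rewrite /cis /= cosN sinN. Qed.

Lemma cnorm2_cis t : cnorm2 (cis t) = 1 :> R.
Proof. by rewrite /cnorm2 /= cos2Dsin2. Qed.

Lemma cvg_Re_cnorm2 (u : nat -> C) (l : C) :
  cnorm2 (u k - l) @[k --> \oo] --> (0 : R) ->
  Re (u k) @[k --> \oo] --> Re l.
Proof.
move=> /cvgrPdist_lt H; apply/cvgrPdist_lt => e e0.
have [N _ HN] := H (e ^+ 2) (exprn_gt0 2 e0).
exists N => // k Nk; have := HN k Nk; rewrite /= sub0r normrN => h.
have key (t : R) : t ^+ 2 < e ^+ 2 -> `|t| < e.
  by rewrite -[t ^+ 2]real_normK ?num_real// ltr_sqr ?nnegrE// ltW.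
apply: key; move: h; rewrite ger0_norm ?cnorm2_ge0//; apply: le_lt_trans.
by apply: le_trans (sqr_Re_le _); rewrite ReD ReN -opprB sqrrN.
Qed.

End ComplexSquares.

Section Baire.
Variables (R : realType) (d : nat).
Local Notation C := R[i].
Local Notation Z := 'rV[int]_d.
Local Notation tp := (@torus_pt R d).
Local Notation Re := (@complex.Re _).
Local Notation Im := (@complex.Im _).
Implicit Types (phi psi f g : 'rV[C]_d -> C) (th : nat -> R) (a b x y : Z) (c : C).

Lemma zpowE th a :
  zpow (tp th) a = cis (\sum_(j < d) (a 0 j)%:~R * (2 * pi * th j)).
Proof.
rewrite /zpow; elim/big_rec2: _ => [|j y1 y2 _ ->]; first by rewrite cis0.
by rewrite cisD mxE -cisX.
Qed.

Lemma zpowD th a b : zpow (tp th) (a + b) = zpow (tp th) a * zpow (tp th) b.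
Proof.
rewrite !zpowE -cisD -big_split /=; congr cis; apply: eq_bigr => j _.
by rewrite mxE intrD mulrDl.
Qed.

Lemma zpowN th a : zpow (tp th) (- a) = conjc (zpow (tp th) a).
Proof.
rewrite !zpowE cis_conj -sumrN; congr cis; apply: eq_bigr => j _.
by rewrite mxE intrN mulNr.
Qed.

Lemma zpow0 th : zpow (tp th) 0 = 1.
Proof.
by rewrite zpowE big1 ?cis0// => j _; rewrite mxE mul0r.
Qed.

Lemma cnorm2_zpow th a : cnorm2 (zpow (tp th) a) = 1.
Proof. by rewrite zpowE cnorm2_cis. Qed.

(* Convergence is required only on the torus, so that membership depends only on
   the restriction to the torus, see [baire_ext]. *)
Inductive baire : ('rV[C]_d -> C) -> Prop :=
| baire_zpow a : baire (fun z => zpow z a)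
| baireD f g : baire f -> baire g -> baire (fun z => f z + g z)
| baireZ c f : baire f -> baire (fun z => c * f z)
| baire_lim (u : nat -> 'rV[C]_d -> C) f (B : R) :
    (forall k, baire (u k)) ->
    (forall k th, cnorm2 (u k (tp th)) <= B) ->
    (forall th, cnorm2 (u k (tp th) - f (tp th)) @[k --> \oo] --> (0 : R)) ->
    baire f.

Lemma baire_bounded f : baire f -> exists B, forall th, cnorm2 (f (tp th)) <= B.
Proof.
elim=> {f} [a|f g _ [B1 H1] _ [B2 H2]|c f _ [B H]|u f B _ _ uB uf].
- by exists 1 => th; rewrite cnorm2_zpow.
- exists (2 * (B1 + B2)) => th; apply: le_trans (cnorm2D_le _ _) _.
  by rewrite ler_pM2l// lerD.
- by exists (cnorm2 c * B) => th; rewrite cnorm2M ler_wpM2l// cnorm2_ge0.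
- exists (2 * (B + 1)) => th.
  (* One term of the sequence at squared distance less than 1 from the limit suffices to bound the
     limit. *)
  have /cvgrPdist_lt /(_ 1 ltr01) [N _ /(_ N (leqnn N))] := uf th.
  rewrite /= sub0r normrN ger0_norm ?cnorm2_ge0// => h.
  rewrite -[f (tp th)](subKr (u N (tp th))); apply: le_trans (cnorm2D_le _ _) _.
  by rewrite cnorm2N ler_pM2l// lerD// ltW.
Qed.

(** Quantifying over [c] makes the scalar case of the induction immediate and yields the imaginary
    part with [c = -i]. *)
Lemma baire_tame f : baire f -> forall c, tame d (fun th => Re (c * f (tp th))).
Proof.
have bnd g c : baire g -> exists B, forall th, `|Re (c * g (tp th))| <= B.
  move=> /(baireZ c) /baire_bounded [B H]; exists (B + 1) => th.
  by apply: le_trans (norm_Re_le _) _; rewrite lerD2r H.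
elim=> {f} [a|f g bf tf bg tg|c' f _ tf|u f B bu tu uB uf] c.
(* [itint_cis] takes exponents indexed by natural numbers, so [a] is extended by 0 beyond its [d]
   entries. *)
- have [+ _] := itint_cis d c (fun k => if insub k is Some j then a 0 j else 0).
  congr tame; apply/funext => th; congr (Re (_ * _)).
  by rewrite /zpow; apply: eq_bigr => j _; rewrite valK mxE -/(cis _) cisX mulrCA mulrA.
- have [B1 H1] := bnd f c bf; have [B2 H2] := bnd g c bg.
  rewrite (_ : (fun th => _) = fun th => Re (c * f (tp th)) + Re (c * g (tp th))).
    have H1' th : `|Re (c * f (tp th))| <= Num.max B1 B2 by rewrite le_max H1.
    have H2' th : `|Re (c * g (tp th))| <= Num.max B1 B2.
      by rewrite le_max H2 orbT.
    exact: (tameD (tf c) (tg c) H1' H2').1.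
  by apply/funext => th; rewrite mulrDr ReD.
- rewrite (_ : (fun th => _) = fun th => Re (c * c' * f (tp th)))//.
  by apply/funext => th; rewrite mulrA.
- have ub k th : `|Re (c * u k (tp th))| <= cnorm2 c * B + 1.
    apply: le_trans (norm_Re_le _) _.
    by rewrite lerD2r cnorm2M ler_wpM2l// cnorm2_ge0.
  refine (tame_lim (fun k => tu k c) ub _).1 => th; apply: cvg_Re_cnorm2.
  rewrite (_ : (fun k => _) = fun k => cnorm2 c * cnorm2 (u k (tp th) - f (tp th))).
    by rewrite -[X in _ --> X](mulr0 (cnorm2 c)); apply: cvgM; [exact: cvg_cst|exact: uf].
  by apply/funext => k; rewrite -mulrBr cnorm2M.
Qed.

(** The constant sequence [f] converges to [g] at all points of the torus. *)
Lemma baire_ext f g : (forall th, f (tp th) = g (tp th)) -> baire f -> baire g.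
Proof.
move=> fg bf; have [B H] := baire_bounded bf.
apply: (@baire_lim (fun _ => f) g B) => // th.
rewrite (_ : (fun _ => _) = fun=> 0); first exact: cvg_cst.
by apply/funext => k; rewrite fg subrr cnorm20.
Qed.

Lemma baire_cst c : baire (fun=> c).
Proof.
apply: baire_ext (baireZ c (baire_zpow 0)) => th.
by rewrite zpow0 mulr1.
Qed.

Lemma baire_sum (I : Type) (r : seq I) (P : pred I) (F : I -> 'rV[C]_d -> C) :
  (forall i, baire (F i)) -> baire (fun z => \sum_(i <- r | P i) F i z).
Proof.
move=> bF; elim: r => [|i r IH].
  by apply: baire_ext (baire_cst 0) => th; rewrite big_nil.
case Pi: (P i).
  by apply: baire_ext (baireD (bF i) IH) => th; rewrite big_cons Pi.
by apply: baire_ext IH => th; rewrite big_cons Pi.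
Qed.

(** Induction on [f], with an inner induction on [g] when [f] is a character. In the limit cases the
    other factor is bounded, so bounded convergence survives the product. *)
Lemma baireM f g : baire f -> baire g -> baire (fun z => f z * g z).
Proof.
move=> bf bg; elim: bf => {f} [a|f h _ bf _ bh|c f _ bf|u f B _ bu uB uf].
- elim: bg => {g} [b|g h _ bg _ bh|c g _ bg|u g B _ bu uB ug].
  + by apply: baire_ext (baire_zpow (a + b)) => th; rewrite zpowD.
  + by apply: baire_ext (baireD bg bh) => th; rewrite mulrDr.
  + by apply: baire_ext (baireZ c bg) => th; rewrite mulrCA.
  + apply: (baire_lim (B := B) bu) => [k th|th].
      by rewrite cnorm2M cnorm2_zpow mul1r.
    apply: cvg_trans (ug th); apply: near_eq_cvg; apply: nearW => k.
    by rewrite -mulrBr cnorm2M cnorm2_zpow mul1r.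
- by apply: baire_ext (baireD bf bh) => th; rewrite mulrDl.
- by apply: baire_ext (baireZ c bf) => th; rewrite mulrA.
- have [B' H'] := baire_bounded bg.
  apply: (baire_lim (B := B * B') bu) => [k th|th].
    by rewrite cnorm2M ler_pM ?cnorm2_ge0.
  rewrite (_ : (fun k => _) = fun k => cnorm2 (u k (tp th) - f (tp th)) * cnorm2 (g (tp th))).
    by rewrite -[X in _ --> X](mul0r (cnorm2 (g (tp th)))); apply: cvgM; [exact: uf|exact: cvg_cst].
  by apply/funext => k; rewrite -mulrBl cnorm2M.
Qed.

Lemma baire_prod (I : Type) (r : seq I) (P : pred I) (F : I -> 'rV[C]_d -> C) :
  (forall i, baire (F i)) -> baire (fun z => \prod_(i <- r | P i) F i z).
Proof.
move=> bF; elim: r => [|i r IH].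
  by apply: baire_ext (baire_cst 1) => th; rewrite big_nil.
case Pi: (P i); last by apply: baire_ext IH => th; rewrite big_cons Pi.
by apply: baire_ext (baireM (bF i) IH) => th; rewrite big_cons Pi.
Qed.

Lemma baire_one_add_zpow a : baire (fun z => 1 + zpow z a).
Proof. by apply: baireD; [exact: baire_cst|exact: baire_zpow]. Qed.

Lemma baireJ f : baire f -> baire (fun z => conjc (f z)).
Proof.
elim=> {f} [a|f h _ bf _ bh|c f _ bf|u f B _ bu uB uf].
- by apply: baire_ext (baire_zpow (- a)) => th; rewrite zpowN.
- by apply: baire_ext (baireD bf bh) => th; rewrite rmorphD.
- by apply: baire_ext (baireZ (conjc c) bf) => th; rewrite rmorphM.
- apply: (baire_lim (B := B) bu) => [k th|th]; first by rewrite cnorm2J.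
  apply: cvg_trans (uf th); apply: near_eq_cvg; apply: nearW => k.
  by rewrite -rmorphB cnorm2J.
Qed.

Lemma baireB f g : baire f -> baire g -> baire (fun z => f z - g z).
Proof.
move=> bf bg; apply: baire_ext (baireD bf (baireZ (-1) bg)) => th.
by rewrite mulN1r.
Qed.

(** A complex number is determined by the real parts of its multiples ([complex_ReP]), so this
    reduces complex linearity of [torus_int] to real linearity of [itint]. *)
Lemma Re_mul_torus_int f c : baire f ->
  Re (c * torus_int f) = itint d (fun th => Re (c * f (tp th))).
Proof.
move=> bf; have [B H] := baire_bounded bf.
have tR : tame d (fun th => Re (f (tp th))).
  by have := baire_tame bf 1; congr tame; apply/funext => th; rewrite mul1r.
have tI : tame d (fun th => Im (f (tp th))).
  have := baire_tame bf (Complex 0 (-1)).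
  by congr tame; apply/funext => th; rewrite -ImE.
have bR th : `|Re (f (tp th))| <= B + 1.
  by apply: le_trans (norm_Re_le _) _; rewrite lerD2r H.
have bI th : `|Im (f (tp th))| <= B + 1.
  rewrite ImE; apply: le_trans (norm_Re_le _) _; rewrite lerD2r cnorm2M.
  by rewrite {1}/cnorm2 /= expr0n add0r sqrrN expr1n mul1r H.
rewrite ReM /= -mulNr.
have [tR' <-] := tameZ (Re c) tR bR; have [tI' <-] := tameZ (- Im c) tI bI.
have HR th : `|Re c * Re (f (tp th))| <= (cnorm2 c + 1) * (B + 1).
  by rewrite normrM ler_pM// norm_Re_le.
have HI th : `|- Im c * Im (f (tp th))| <= (cnorm2 c + 1) * (B + 1).
  rewrite normrM ler_pM// normrN ImE; apply: le_trans (norm_Re_le _) _.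
  by rewrite cnorm2M {1}/cnorm2 /= expr0n add0r sqrrN expr1n mul1r.
rewrite -(tameD tR' tI' HR HI).2.
by congr itint; apply/funext => th; rewrite ReM mulNr.
Qed.

Lemma torus_int_ext f g : (forall th, f (tp th) = g (tp th)) ->
  torus_int f = torus_int g.
Proof.
move=> fg; rewrite /torus_int.
by congr Complex; congr itint; apply/funext => th; rewrite fg.
Qed.

Lemma complex_ReP (x y : C) : (forall c, Re (c * x) = Re (c * y)) -> x = y.
Proof.
move=> H; apply: complexP; last by rewrite !ImE H.
by have := H 1; rewrite !mul1r.
Qed.

Lemma torus_intD f g : baire f -> baire g ->
  torus_int (fun z => f z + g z) = torus_int f + torus_int g.
Proof.
move=> bf bg; apply: complex_ReP => c.
rewrite mulrDr ReD !Re_mul_torus_int//; last exact: baireD.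
have [B1 /= H1] := baire_bounded (baireZ c bf).
have [B2 /= H2] := baire_bounded (baireZ c bg).
have H1' th : `|Re (c * f (tp th))| <= Num.max B1 B2 + 1.
  by apply: le_trans (norm_Re_le _) _; rewrite lerD2r le_max H1.
have H2' th : `|Re (c * g (tp th))| <= Num.max B1 B2 + 1.
  by apply: le_trans (norm_Re_le _) _; rewrite lerD2r le_max H2 orbT.
rewrite -(tameD (baire_tame bf c) (baire_tame bg c) H1' H2').2.
by congr itint; apply/funext => th; rewrite mulrDr ReD.
Qed.

Lemma torus_intZ f c : baire f ->
  torus_int (fun z => c * f z) = c * torus_int f.
Proof.
move=> bf; apply: complex_ReP => c'.
rewrite mulrA !Re_mul_torus_int//; last exact: baireZ.
by congr itint; apply/funext => th; rewrite mulrA.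
Qed.

Lemma torus_int_zpow a :
  torus_int (fun z : 'rV[C]_d => zpow z a) = (a == 0)%:R :> C.
Proof.
apply: complex_ReP => c; rewrite Re_mul_torus_int; last exact: baire_zpow.
pose a' k : int := if insub k is Some j then a 0 j else 0.
have <- : \prod_(k < d) (a' k == 0)%:R = (a == 0)%:R :> C.
  have [a00|a0] := eqVneq a 0.
    by rewrite big1// => j _; rewrite /a' valK a00 mxE.
  have [j aj] : exists j, a 0 j != 0.
    apply/existsP; apply: contraNT a0 => /existsPn H; apply/eqP/rowP => j.
    by rewrite mxE; apply/eqP; rewrite -[_ == _]negbK H.
  by rewrite (bigD1 j)//= /a' valK (negbTE aj) mul0r.
rewrite -(itint_cis d c a').2; congr itint; apply/funext => th.
congr (Re (_ * _)); rewrite /zpow; apply: eq_bigr => j _.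
by rewrite /a' valK mxE -/(cis _) cisX mulrCA mulrA.
Qed.

End Baire.

(** * Fourier coefficients, mean squares and Bessel's inequality *)

Section FourierCoefficients.
Variables (R : realType) (d : nat).
Local Notation C := R[i].
Local Notation Z := 'rV[int]_d.
Local Notation tp := (@torus_pt R d).
Local Notation Re := (@complex.Re _).
Local Notation Im := (@complex.Im _).
Implicit Types (phi psi f g : 'rV[C]_d -> C) (th : nat -> R) (a b x y : Z) (c : C).

Definition hat f x : C := torus_int (fun z => zpow z (- x) * f z).

(** The squared norm of [f] in [L^2] of the torus. *)
Definition energy f : R := itint d (fun th => cnorm2 (f (tp th))).

Lemma baire_twist f x : baire f -> baire (fun z => zpow z (- x) * f z).
Proof. by move=> bf; apply: baireM => //; exact: baire_zpow. Qed.

Lemma hat_ext f g x : (forall th, f (tp th) = g (tp th)) -> hat f x = hat g x.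
Proof. by move=> fg; rewrite /hat; apply: torus_int_ext => th; rewrite fg. Qed.

Lemma hatD f g x : baire f -> baire g ->
  hat (fun z => f z + g z) x = hat f x + hat g x.
Proof.
move=> bf bg; rewrite -torus_intD; [|exact: baire_twist..].
by rewrite /hat; apply: torus_int_ext => th; rewrite mulrDr.
Qed.

Lemma hatZ c f x : baire f -> hat (fun z => c * f z) x = c * hat f x.
Proof.
move=> bf; rewrite -torus_intZ; last exact: baire_twist.
by rewrite /hat; apply: torus_int_ext => th; rewrite mulrCA.
Qed.

Lemma hat0 x : hat (fun=> 0) x = 0.
Proof.
have := hatZ 0 x (baire_cst d (0 : C)); rewrite !mul0r; exact.
Qed.

Lemma hatB f g x : baire f -> baire g ->
  hat (fun z => f z - g z) x = hat f x - hat g x.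
Proof.
move=> bf bg; rewrite -mulN1r -(hatZ (-1))// -hatD//; last exact: baireZ.
by apply: hat_ext => th; rewrite mulN1r.
Qed.

Lemma hat_zpow b x : hat (fun z => zpow z b) x = (x == b)%:R.
Proof.
rewrite eq_sym -subr_eq0 -torus_int_zpow; rewrite /hat; apply: torus_int_ext => th.
by rewrite -zpowD addrC.
Qed.

Lemma hat_mul_zpow f b x : hat (fun z => f z * zpow z b) x = hat f (x - b).
Proof.
rewrite /hat; apply: torus_int_ext => th.
by rewrite opprB addrC zpowD -!mulrA [zpow _ b * _]mulrC.
Qed.

Lemma itint_Re f : baire f -> itint d (fun th => Re (f (tp th))) = Re (torus_int f).
Proof.
move=> bf; rewrite -[torus_int f]mul1r Re_mul_torus_int//.
by congr itint; apply/funext => th; rewrite mul1r.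
Qed.

Lemma baire_cnorm2 f : baire f -> baire (fun z => (cnorm2 (f z))%:C%C).
Proof.
move=> bf; apply: baire_ext (baireM bf (baireJ bf)) => th.
by rewrite mulcJE.
Qed.

Lemma energy_tame f : baire f -> tame d (fun th => cnorm2 (f (tp th))).
Proof.
move=> /baire_cnorm2 bf; have := baire_tame bf 1; congr tame.
by apply/funext => th; rewrite mul1r.
Qed.

Lemma energyE f : baire f -> energy f = Re (torus_int (fun z => (cnorm2 (f z))%:C%C)).
Proof. by move=> bf; rewrite -itint_Re//; exact: baire_cnorm2. Qed.

Lemma energy_le f g : baire f -> baire g ->
  (forall th, cnorm2 (f (tp th)) <= cnorm2 (g (tp th))) -> energy f <= energy g.
Proof.
move=> bf bg fg; have [B H] := baire_bounded bg.
apply: (itint_le (B := B) (energy_tame bf) (energy_tame bg)) => // th;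
  rewrite ger0_norm ?cnorm2_ge0//; exact: le_trans (fg th) (H th).
Qed.

Lemma energy0 : energy (fun=> 0) = 0.
Proof.
rewrite /energy (_ : (fun=> _) = fun th => Re (0 * zpow (tp th) 0)).
  by rewrite -(Re_mul_torus_int 0 (baire_zpow R 0)) mul0r.
by apply/funext => th; rewrite mul0r cnorm20.
Qed.

Lemma energy_ge0 f : baire f -> 0 <= energy f.
Proof.
move=> bf; rewrite -energy0; apply: energy_le => //; first exact: baire_cst.
by move=> th; rewrite cnorm20 cnorm2_ge0.
Qed.

Lemma energyZ c f : baire f -> energy (fun z => c * f z) = cnorm2 c * energy f.
Proof.
move=> bf; have [B H] := baire_bounded bf.
rewrite /energy -(tameZ (cnorm2 c) (energy_tame bf) (B := B) _).2.
  by congr itint; apply/funext => th; rewrite cnorm2M.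
by move=> th; rewrite ger0_norm ?cnorm2_ge0.
Qed.

Lemma energy_mul_le f g (B : R) : baire f -> baire g ->
  (forall th, cnorm2 (f (tp th)) <= B) ->
  energy (fun z => f z * g z) <= B * energy g.
Proof.
move=> bf bg fB; have B0 : 0 <= B.
  by apply: le_trans (fB (fun=> 0)); exact: cnorm2_ge0.
have -> : B = cnorm2 (Num.sqrt B)%:C%C.
  by rewrite /cnorm2 /= expr0n addr0 sqr_sqrtr.
rewrite -energyZ//; apply: energy_le; [exact: baireM|exact: baireZ|].
move=> th; rewrite !cnorm2M ler_wpM2r ?cnorm2_ge0//.
by rewrite {2}/cnorm2 /= expr0n addr0 sqr_sqrtr.
Qed.

(** Expansion of the square, using [|z^x| = 1]. Taking [c = hat f x] gives the induction step of
    Bessel's inequality; taking [f] a trigonometric polynomial gives that of [energy_trig]. *)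
Lemma energy_sub_zpow f c x : baire f ->
  energy (fun z => f z - c * zpow z x) =
  energy f - 2 * Re (conjc c * hat f x) + cnorm2 c.
Proof.
move=> bf.
(* On the torus [G] has real part [|f - c z^x|^2]; its middle term need not be real. The constant is
   written as a multiple of [z^0] so that [torus_int_zpow] integrates it. *)
pose G z : C := (cnorm2 (f z))%:C%C +
  ((- 2 * conjc c) * (zpow z (- x) * f z) + (cnorm2 c)%:C%C * zpow z 0).
have bt := baire_twist x bf; have bn := baire_cnorm2 bf.
have bG : baire G.
  by apply: baireD => //; apply: baireD; apply: baireZ => //; exact: baire_zpow.
transitivity (Re (torus_int G)).
  rewrite -itint_Re//; congr itint; apply/funext => th.
  rewrite /G zpow0 zpowN; have := cnorm2_zpow th x.
  move: (f _) (zpow _ _) => u v; rewrite /cnorm2.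
  case: u v c {bG G} => u1 u2 [v1 v2] [c1 c2] /= v12.
  apply/eqP; rewrite -subr_eq0; apply/eqP.
  transitivity ((c1 ^+ 2 + c2 ^+ 2) * (v1 ^+ 2 + v2 ^+ 2 - 1)); first by ring.
  by rewrite v12 subrr mulr0.
rewrite /G torus_intD//; last first.
  by apply: baireD; apply: baireZ => //; exact: baire_zpow.
rewrite torus_intD; [|by apply: baireZ => //; exact: baire_zpow..].
rewrite !torus_intZ//; last exact: baire_zpow.
rewrite torus_int_zpow eqxx mulr1 !ReD -energyE// addrA -mulrA; congr (_ + _ + _).
by case: (_ * hat _ _) => w1 w2; rewrite ReM /=; ring.
Qed.

(** Subtracting the component of [f] along [z^x] lowers the energy by [|hat f x|^2] and leaves the
    coefficients at all other points unchanged. *)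
Lemma bessel f (s : seq Z) : baire f -> uniq s ->
  \sum_(x <- s) cnorm2 (hat f x) <= energy f.
Proof.
elim: s f => [|x s IH] f bf; first by rewrite big_nil energy_ge0.
rewrite big_cons /= => /andP[xs us].
pose g z := f z - hat f x * zpow z x.
have bg : baire g by apply: baireB => //; apply: baireZ; exact: baire_zpow.
have Eg : energy g = energy f - cnorm2 (hat f x).
  by rewrite energy_sub_zpow// [conjc _ * _]mulrC mulcJE /=; ring.
rewrite addrC -lerBrDr -Eg; apply: le_trans (IH _ bg us).
rewrite le_eqVlt; apply/orP; left; apply/eqP.
rewrite !big_seq; apply: eq_bigr => y ys; rewrite hatB//; last first.
  by apply: baireZ; exact: baire_zpow.
rewrite hatZ ?hat_zpow; last exact: baire_zpow.
by rewrite (_ : y == x = false) ?mulr0 ?subr0//; apply: contraNF xs => /eqP <-.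
Qed.

Lemma baire_trig (s : seq Z) (c : Z -> C) :
  baire (fun z => \sum_(x <- s) c x * zpow z x).
Proof. by apply: baire_sum => x; apply: baireZ; exact: baire_zpow. Qed.

Lemma hat_trig (s : seq Z) (c : Z -> C) y : uniq s ->
  hat (fun z => \sum_(x <- s) c x * zpow z x) y = if y \in s then c y else 0.
Proof.
elim: s => [|x s IH].
  by move=> _; rewrite in_nil -[RHS](hat0 y); apply: hat_ext => th; rewrite big_nil.
move=> /= /andP[xs us].
have bx : baire (fun z : 'rV[C]_d => zpow z x) by exact: baire_zpow.
transitivity (hat (fun z => c x * zpow z x + \sum_(x <- s) c x * zpow z x) y).
  by apply: hat_ext => th; rewrite big_cons.
rewrite hatD; [|exact: baireZ|exact: baire_trig].
rewrite hatZ// hat_zpow IH// inE; have [->|_] := eqVneq y x.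
  by rewrite (negbTE xs) mulr1 addr0.
by rewrite mulr0 add0r.
Qed.

(** When the term at [x] is peeled off, the remaining polynomial has coefficient 0 at [x], so the
    cross term vanishes. *)
Lemma energy_trig (s : seq Z) (c : Z -> C) : uniq s ->
  energy (fun z => \sum_(x <- s) c x * zpow z x) = \sum_(x <- s) cnorm2 (c x).
Proof.
elim: s => [|x s IH].
  by move=> _; rewrite big_nil -energy0; congr energy; apply/funext => z; rewrite big_nil.
move=> /= /andP[xs us]; rewrite big_cons -IH//.
transitivity (energy (fun z => \sum_(x <- s) c x * zpow z x - (- c x) * zpow z x)).
  by congr energy; apply/funext => z; rewrite big_cons mulNr opprK addrC.
rewrite energy_sub_zpow; last exact: baire_trig.
by rewrite hat_trig// (negbTE xs) mulr0 mulr0 subr0 cnorm2N addrC.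
Qed.

Lemma energy_cvg0 (u : nat -> 'rV[C]_d -> C) f (B : R) :
  (forall k, baire (u k)) -> baire f ->
  (forall k th, cnorm2 (u k (tp th)) <= B) ->
  (forall th, cnorm2 (u k (tp th) - f (tp th)) @[k --> \oo] --> (0 : R)) ->
  energy (fun z => u k z - f z) @[k --> \oo] --> (0 : R).
Proof.
move=> bu bf uB uf; have [B' H] := baire_bounded bf.
rewrite -energy0.
have tu k := energy_tame (baireB (bu k) bf).
have ub k th : `|cnorm2 (u k (tp th) - f (tp th))| <= 2 * (B + B').
  rewrite ger0_norm ?cnorm2_ge0//.
  by apply: le_trans (cnorm2D_le _ _) _; rewrite cnorm2N ler_pM2l// lerD.
by refine (tame_lim tu ub _).2 => th; rewrite cnorm20; exact: uf.
Qed.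

End FourierCoefficients.

(** * Unordered sums and square-summable families *)

Section Sums.
Variables (R : realType) (T : choiceType).
Local Notation C := R[i].
Local Notation Re := (@complex.Re _).
Local Notation Im := (@complex.Im _).
Implicit Types (p : T -> R) (s t : seq T).

Lemma esum_seq_le p s : uniq s ->
  ((\sum_(x <- s) p x)%:E <= \esum_(x in [set: T]) (p x)%:E)%E.
Proof.
move=> us; apply: ereal_sup_ubound; exists [set` s].
  by split => //; exact: finite_seq.
by rewrite -fsbig_seq// sumEFin.
Qed.

Lemma esum_le_seq p (c : \bar R) :
  (forall s, uniq s -> ((\sum_(x <- s) p x)%:E <= c)%E) ->
  (\esum_(x in [set: T]) (p x)%:E <= c)%E.
Proof.
move=> H; apply: ge_ereal_sup => _ [A [fA _] <-].
by rewrite fsbig_finite//= sumEFin; apply: H; exact: finmap.fset_uniq.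
Qed.

Lemma sum_le_subset p s t : (forall x, 0 <= p x) -> uniq s -> uniq t ->
  {subset s <= t} -> \sum_(x <- s) p x <= \sum_(x <- t) p x.
Proof.
move=> p0 us ut st.
have st' : perm_eq s [seq x <- t | x \in s].
  apply: uniq_perm => //; first exact: filter_uniq.
  by move=> x; rewrite mem_filter; case xs: (x \in s) => //=; rewrite st.
by rewrite (perm_big _ st')/= big_filter [leRHS](bigID (mem s))/= lerDl sumr_ge0.
Qed.

(** Some finite family comes within [e] of the supremum, and as [p] is nonnegative every larger
    finite family does too. *)
Lemma esum_approx p (c : R) : (forall x, 0 <= p x) ->
  (forall s, uniq s -> \sum_(x <- s) p x <= c) ->
  let P := fine (\esum_(x in [set: T]) (p x)%:E) in
  (forall s, uniq s -> \sum_(x <- s) p x <= P) /\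
  forall e, 0 < e -> exists s0, uniq s0 /\ forall s, uniq s ->
    {subset s0 <= s} -> P - e < \sum_(x <- s) p x.
Proof.
move=> p0 pc P.
have fin : \esum_(x in [set: T]) (p x)%:E \is a fin_num.
  rewrite ge0_fin_numE; last by apply: esum_ge0 => x _; rewrite lee_fin.
  by apply: le_lt_trans (ltry c); apply: esum_le_seq => s us; rewrite lee_fin pc.
split=> [s us|e e0]; first by rewrite -lee_fin fineK//; exact: esum_seq_le.
have [_ [A [fA _] <-]] := ub_ereal_sup_adherent e0 fin.
rewrite fsbig_finite//= sumEFin -/(esum _ _) -(fineK fin) -EFinB lte_fin => h.
exists (finmap.enum_fset (fset_set A)); split=> [|s us As]; first exact: finmap.fset_uniq.
apply: lt_le_trans h _; apply: sum_le_subset => //.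
Qed.

(** The bound [c] makes both sums inside [rsum] finite, so [fine] returns their true values.
    Positive and negative parts are approximated separately, and the union of the two finite
    families serves for the difference. *)
Lemma rsum_approx (h : T -> R) (c : R) :
  (forall s, uniq s -> \sum_(x <- s) `|h x| <= c) ->
  forall e, 0 < e -> exists s0, forall s, uniq s -> {subset s0 <= s} ->
    `|\sum_(x <- s) h x - rsum h| < e.
Proof.
move=> hc e e0.
have pos (k : T -> R) x : 0 <= Num.max (k x) 0 by rewrite le_max lexx orbT.
have hN x : - h x <= `|h x| by rewrite -normrN ler_norm.
have bnd (k : T -> R) : (forall x, k x <= `|h x|) ->
    forall s, uniq s -> \sum_(x <- s) Num.max (k x) 0 <= c.
  move=> kh s us; apply: le_trans (hc s us); apply: ler_sum => x _.
  by rewrite ge_max kh normr_ge0.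
have [P1 /(_ e e0) [s1 [us1 H1]]] :=
  esum_approx (pos h) (bnd h (fun x => ler_norm _)).
have [N1 /(_ e e0) [s2 [us2 H2]]] :=
  esum_approx (pos (fun x => - h x)) (bnd (fun x => - h x) hN).
exists (s1 ++ s2) => s us ss.
have -> : \sum_(x <- s) h x =
    \sum_(x <- s) Num.max (h x) 0 - \sum_(x <- s) Num.max (- h x) 0.
  rewrite -sumrB; apply: eq_bigr => x _.
  by have [h0|h0] := leP (h x) 0; have [h1|h1] := leP (- h x) 0; lra.
have := H1 s us _; have := H2 s us _; have := P1 s us; have := N1 s us.
rewrite /rsum; set N := fine _; set P := fine _.
set n := \sum_(_ <- _) _; set p := \sum_(_ <- _) _ => h1 h2 h3 h4.
have {}h3 : N - e < n by apply: h3 => x xs; rewrite ss// mem_cat xs orbT.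
have {}h4 : P - e < p by apply: h4 => x xs; rewrite ss// mem_cat xs.
by rewrite ltr_norml; apply/andP; split; lra.
Qed.

Local Notation normc := Normc.normc.
Implicit Types (g u v : T -> C) (z S : C).

Lemma normcE2 z : normc z = Num.sqrt (cnorm2 z). Proof. by case: z. Qed.

Lemma normc_ge0 z : 0 <= normc z. Proof. by rewrite normcE2 sqrtr_ge0. Qed.

Lemma normc_sqr z : normc z ^+ 2 = cnorm2 z.
Proof. by rewrite normcE2 sqr_sqrtr// cnorm2_ge0. Qed.

Lemma normc_Re z : `|Re z| <= normc z.
Proof. by rewrite normcE2 -sqrtr_sqr ler_wsqrtr// sqr_Re_le. Qed.

Lemma normc_Im z : `|Im z| <= normc z.
Proof. by rewrite normcE2 -sqrtr_sqr ler_wsqrtr// lerDr sqr_ge0. Qed.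

Lemma normc_le_ReIm z : normc z <= `|Re z| + `|Im z|.
Proof.
rewrite normcE2 -[leRHS]ger0_norm ?addr_ge0// -sqrtr_sqr ler_wsqrtr//.
rewrite /cnorm2 sqrrD !real_normK ?num_real// lerD2r lerDl.
by rewrite mulrn_wge0// mulr_ge0.
Qed.

(** Convergence along the net of finite subsets. Identities between values of [csum] are derived
    from [csumP] and uniqueness of this limit. *)
Definition has_csum g S := forall e : R, 0 < e -> exists s0, forall s,
  uniq s -> {subset s0 <= s} -> normc (\sum_(x <- s) g x - S) < e.

Definition abs_summable g := exists c : R, forall s, uniq s ->
  \sum_(x <- s) normc (g x) <= c.

Lemma Re_sum s g : Re (\sum_(x <- s) g x) = \sum_(x <- s) Re (g x).
Proof. by elim/big_rec2: _ => //= x y1 y2 _ <-; rewrite ReD. Qed.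

Lemma Im_sum s g : Im (\sum_(x <- s) g x) = \sum_(x <- s) Im (g x).
Proof. by elim/big_rec2: _ => //= x y1 y2 _ <-; rewrite ImD. Qed.

Lemma csumP g : abs_summable g -> has_csum g (csum g).
Proof.
move=> [c gc] e e0; have e20 : 0 < e / 2 by rewrite divr_gt0.
have [|s1 H1] := @rsum_approx (fun x => Re (g x)) c _ (e / 2) e20.
  by move=> s us; apply: le_trans (gc s us); apply: ler_sum => x _; exact: normc_Re.
have [|s2 H2] := @rsum_approx (fun x => Im (g x)) c _ (e / 2) e20.
  by move=> s us; apply: le_trans (gc s us); apply: ler_sum => x _; exact: normc_Im.
exists (s1 ++ s2) => s us ss; apply: le_lt_trans (normc_le_ReIm _) _.
rewrite ReD ImD ReN ImN Re_sum Im_sum /= [e]splitr; apply: ltrD.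
  by apply: H1 => // x xs; rewrite ss// mem_cat xs.
by apply: H2 => // x xs; rewrite ss// mem_cat xs orbT.
Qed.

Lemma has_csum_uniq g S S' : has_csum g S -> has_csum g S' -> S = S'.
Proof.
move=> H H'; apply/eqP; rewrite -subr_eq0; apply/eqP; apply: Normc.eq0_normc.
apply/eqP; rewrite eq_le normc_ge0 andbT; apply/ler_addgt0Pl => e e0.
have [s1 H1] := H _ (divr_gt0 e0 (ltr0n _ 2)).
have [s2 H2] := H' _ (divr_gt0 e0 (ltr0n _ 2)).
pose s := undup (s1 ++ s2); have us : uniq s by exact: undup_uniq.
have := H1 s us _; have := H2 s us _; set X := \sum_(_ <- _) _ => h2 h1.
rewrite addr0 (_ : S - S' = - (X - S) + (X - S')); last by ring.
apply: le_trans (le_normcD _ _) _; rewrite normcN [e]splitr lerD// ltW//.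
  by apply: h1 => x xs; rewrite mem_undup mem_cat xs.
by apply: h2 => x xs; rewrite mem_undup mem_cat xs orbT.
Qed.

Lemma has_csumD u v S S' : has_csum u S -> has_csum v S' ->
  has_csum (fun x => u x + v x) (S + S').
Proof.
move=> H H' e e0.
have [s1 H1] := H _ (divr_gt0 e0 (ltr0n _ 2)).
have [s2 H2] := H' _ (divr_gt0 e0 (ltr0n _ 2)).
exists (s1 ++ s2) => s us ss; rewrite big_split /= opprD addrACA.
apply: le_lt_trans (le_normcD _ _) _; rewrite [e]splitr ltrD//.
  by apply: H1 => // x xs; rewrite ss// mem_cat xs.
by apply: H2 => // x xs; rewrite ss// mem_cat xs orbT.
Qed.

Lemma has_csumZ z u S : has_csum u S -> has_csum (fun x => z * u x) (z * S).
Proof.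
move=> H e e0; have z0 : 0 < normc z + 1 by rewrite ltr_wpDl// normc_ge0.
have [s0 H0] := H _ (divr_gt0 e0 z0).
exists s0 => s us ss; rewrite -mulr_sumr -mulrBr Normc.normcM.
have := H0 s us ss; rewrite ltr_pdivlMr//; apply: le_lt_trans.
by rewrite mulrC ler_wpM2l ?normc_ge0// lerDl.
Qed.

Lemma has_csum_finite s0 u : uniq s0 -> (forall x, x \notin s0 -> u x = 0) ->
  has_csum u (\sum_(x <- s0) u x).
Proof.
move=> us0 u0 e e0; exists s0 => s us ss.
rewrite (bigID (mem s0))/= [X in _ + X - _]big1 ?addr0; last by move=> x; exact: u0.
rewrite -big_filter (perm_big s0) ?subrr ?Normc.normc0//.
apply: uniq_perm => //; first exact: filter_uniq.
by move=> x; rewrite mem_filter; case xs: (x \in s0) => //=; rewrite ss.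
Qed.

Lemma has_csum_norm_le g S (M : R) : has_csum g S ->
  (forall s, uniq s -> normc (\sum_(x <- s) g x) <= M) -> normc S <= M.
Proof.
move=> H gM; apply/ler_addgt0Pl => e e0; have [s0 H0] := H e e0.
have := H0 _ (undup_uniq s0); set X := \sum_(_ <- _) _ => h.
rewrite -[S](_ : - (X - S) + X = S); last by ring.
apply: le_trans (le_normcD _ _) _; rewrite normcN lerD//.
  by rewrite ltW// h// => x; rewrite mem_undup.
by apply: gM; exact: undup_uniq.
Qed.

Definition l2le u (c : R) := forall s, uniq s -> \sum_(x <- s) cnorm2 (u x) <= c.

(** Induction on [s]: with [X] the sum so far and [A], [B] the squared norms so far, only the cross
    terms produced by one more entry have to be compared. *)
Lemma cauchy_schwarz_seq s u v :
  cnorm2 (\sum_(x <- s) u x * v x) <=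
  (\sum_(x <- s) cnorm2 (u x)) * (\sum_(x <- s) cnorm2 (v x)).
Proof.
rewrite -normc_sqr; elim: s => [|x s]; rewrite ?big_nil ?mul0r ?Normc.normc0 ?expr0n//.
rewrite !big_cons -![cnorm2 _]normc_sqr.
set X := \sum_(_ <- _) _; set A := \sum_(_ <- _) _; set B := \sum_(_ <- _) _.
have A0 : 0 <= A by apply: sumr_ge0 => ? _; exact: cnorm2_ge0.
have B0 : 0 <= B by apply: sumr_ge0 => ? _; exact: cnorm2_ge0.
move: (normc_ge0 (u x)) (normc_ge0 (v x)) (normc_ge0 X).
have: normc (u x * v x + X) <= normc (u x) * normc (v x) + normc X.
  by rewrite -Normc.normcM le_normcD.
move: (normc_ge0 (u x * v x + X)).
move: (normc (_ + _)) (normc (u x)) (normc (v x)) (normc X) => Y a b x' Y0 Yle a0 b0 x0 IH.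
have : Y ^+ 2 <= (a * b + x') ^+ 2 by rewrite ler_sqr ?nnegrE// addr_ge0 ?mulr_ge0.
move=> /le_trans; apply.
(* Both sides are nonnegative and are compared after squaring: [x'^2 <= A B], and
   [(A b^2 + B a^2)^2] exceeds [4 A B (a b)^2] by the square of [A b^2 - B a^2]. *)
suff : 2 * (x' * (a * b)) <= A * b ^+ 2 + B * a ^+ 2.
  by move: IH; rewrite !expr2; nra.
rewrite -ler_sqr ?nnegrE ?addr_ge0 ?mulr_ge0 ?sqr_ge0//.
have h1 : x' ^+ 2 * (a * b) ^+ 2 <= A * B * (a * b) ^+ 2 by rewrite ler_wpM2r// sqr_ge0.
have h2 := sqr_ge0 (A * b ^+ 2 - B * a ^+ 2).
rewrite -subr_ge0; apply: le_trans (_ : 0 <= (A * b ^+ 2 - B * a ^+ 2) ^+ 2 +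
  4 * (A * B * (a * b) ^+ 2 - x' ^+ 2 * (a * b) ^+ 2)) _.
  by rewrite addr_ge0// mulr_ge0// subr_ge0.
by rewrite le_eqVlt; apply/orP; left; apply/eqP; ring.
Qed.

Lemma l2le_ge0 u c : l2le u c -> 0 <= c.
Proof. by move=> /(_ [::] isT); rewrite big_nil. Qed.

Lemma abs_summable_mul u v c c' : l2le u c -> l2le v c' ->
  abs_summable (fun x => u x * v x).
Proof.
move=> uc vc; exists (c + c') => s us.
apply: le_trans (lerD (uc s us) (vc s us)); rewrite -big_split /=.
apply: ler_sum => x _; rewrite Normc.normcM -!normc_sqr.
have := sqr_ge0 (normc (u x) - normc (v x)).
have := mulr_ge0 (normc_ge0 (u x)) (normc_ge0 (v x)).
by rewrite !expr2; nra.
Qed.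

Lemma csum_mul_le u v c c' : l2le u c -> l2le v c' ->
  cnorm2 (csum (fun x => u x * v x)) <= c * c'.
Proof.
move=> uc vc; have c0 := l2le_ge0 uc; have c0' := l2le_ge0 vc.
rewrite -normc_sqr -[leRHS]sqr_sqrtr ?mulr_ge0//.
rewrite ler_sqr ?nnegrE ?normc_ge0 ?sqrtr_ge0//.
apply: has_csum_norm_le (csumP (abs_summable_mul uc vc)) _ => s us.
rewrite normcE2 ler_wsqrtr//; apply: le_trans (cauchy_schwarz_seq _ _ _) _.
by apply: ler_pM; rewrite ?uc ?vc// sumr_ge0// => ? _; exact: cnorm2_ge0.
Qed.

Lemma csum_mulDl u u' v c1 c2 c : l2le u c1 -> l2le u' c2 -> l2le v c ->
  csum (fun x => (u x + u' x) * v x) =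
  csum (fun x => u x * v x) + csum (fun x => u' x * v x).
Proof.
move=> h1 h2 hv; apply: (@has_csum_uniq (fun x => (u x + u' x) * v x)).
  apply: csumP; have [k Hk] := abs_summable_mul h1 hv.
  have [k' Hk'] := abs_summable_mul h2 hv.
  exists (k + k') => s us; apply: le_trans (lerD (Hk s us) (Hk' s us)).
  rewrite -big_split; apply: ler_sum => x _ /=; rewrite mulrDl; exact: le_normcD.
have := has_csumD (csumP (abs_summable_mul h1 hv)) (csumP (abs_summable_mul h2 hv)).
by congr has_csum; apply/funext => x; rewrite mulrDl.
Qed.

Lemma csumZ z g : abs_summable g -> csum (fun x => z * g x) = z * csum g.
Proof.
move=> sg; apply: (@has_csum_uniq (fun x => z * g x)).
  apply: csumP; have [c H] := sg; exists (normc z * c) => s us.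
  under eq_bigr do rewrite Normc.normcM.
  by rewrite -mulr_sumr ler_wpM2l// ?normc_ge0// H.
by apply: has_csumZ; exact: csumP.
Qed.

Lemma l2leD u v c c' : l2le u c -> l2le v c' ->
  l2le (fun x => u x + v x) (2 * (c + c')).
Proof.
move=> uc vc s us; apply: le_trans (_ : \sum_(x <- s) 2 * (cnorm2 (u x) + cnorm2 (v x)) <= _).
  by apply: ler_sum => x _; exact: cnorm2D_le.
by rewrite -mulr_sumr big_split /= ler_pM2l// lerD ?uc ?vc.
Qed.

Lemma l2leZ z u c : l2le u c -> l2le (fun x => z * u x) (cnorm2 z * c).
Proof.
move=> uc s us; under eq_bigr do rewrite cnorm2M.
by rewrite -mulr_sumr ler_wpM2l ?cnorm2_ge0// uc.
Qed.

Definition off s u : T -> C := fun x => if x \in s then 0 else u x.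

Lemma l2le_off s u c : l2le u c -> l2le (off s u) c.
Proof.
move=> uc t ut; apply: le_trans (uc t ut); apply: ler_sum => x _.
by rewrite /off; case: ifP => // _; rewrite cnorm20 cnorm2_ge0.
Qed.

Lemma l2le_tail u c : l2le u c ->
  forall e : R, 0 < e -> exists s, uniq s /\ l2le (off s u) e.
Proof.
move=> uc e e0.
have [P1 /(_ e e0) [s0 [us0 H]]] := esum_approx (fun x => cnorm2_ge0 (u x)) uc.
exists s0; split => // t ut.
have := H s0 us0 (fun _ => id).
have ut' : uniq (s0 ++ [seq x <- t | x \notin s0]).
  rewrite cat_uniq us0 filter_uniq// andbT; apply/hasPn => x.
  by rewrite mem_filter => /andP[].
have := P1 _ ut'; rewrite big_cat /= big_filter.
set P := fine _; rewrite (_ : \sum_(i <- t | _) _ = \sum_(x <- t) cnorm2 (off s0 u x)).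
  by move=> h1 h2; lra.
rewrite big_mkcond; apply: eq_bigr => x _; rewrite /off.
by case: (x \in s0) => //=; rewrite cnorm20.
Qed.

Definition delta (a x : T) : C := (x == a)%:R.

Lemma l2le_delta a : l2le (delta a) 1.
Proof.
move=> s us; have [xs|xs] := boolP (a \in s).
  rewrite (bigD1_seq a)//= /delta eqxx /cnorm2 /= expr1n expr0n addr0.
  rewrite big1 ?addr0// => x /negPf ->.
  by rewrite /= expr0n addr0.
rewrite big_seq big1 ?ler01// => x xs'; rewrite /delta.
have [xa|_] := eqVneq x a; last exact: cnorm20.
by move: xs; rewrite -xa xs'.
Qed.

(** A density argument: linearity and the vanishing on point masses allow finitely many values of
    [u] to be erased without changing [l u], and the remaining tail has arbitrarily small norm. *)
Lemma l2_functional0 (l : (T -> C) -> C) (K : R) :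
  (forall u v, (exists c, l2le u c) -> (exists c, l2le v c) ->
    l (fun x => u x + v x) = l u + l v) ->
  (forall z u, (exists c, l2le u c) -> l (fun x => z * u x) = z * l u) ->
  (forall u c, l2le u c -> cnorm2 (l u) <= K * c) ->
  (forall a, l (delta a) = 0) ->
  forall u, (exists c, l2le u c) -> l u = 0.
Proof.
move=> lD lZ lK ld u [c uc].
have loff s : uniq s -> l (off s u) = l u.
  elim: s => [|a s IH] /=; first by move=> _; congr l.
  move=> /andP[as_ us]; rewrite -IH//.
  have -> : off s u = fun x => off (a :: s) u x + u a * delta a x.
    apply/funext => x; rewrite /off /delta inE; have [->|xa] := eqVneq x a.
      by rewrite (negbTE as_) mulr1 add0r.
    by rewrite mulr0 addr0.
  rewrite lD ?lZ ?ld ?mulr0 ?addr0//.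
  - by exists 1; exact: l2le_delta.
  - by exists c; exact: l2le_off.
  - by eexists; apply: l2leZ; exact: l2le_delta.
apply/eqP; rewrite -cnorm2_eq0 eq_le cnorm2_ge0 andbT.
apply/ler_addgt0Pl => e e0; rewrite addr0.
(* [K] has no prescribed sign and may be 0; [|K| + 1] is positive and dominates it. *)
have K0 : 0 < `|K| + 1 by rewrite ltr_wpDl.
have [s [us us']] := l2le_tail uc (divr_gt0 e0 K0).
rewrite -(loff s us); apply: le_trans (lK _ _ us') _.
rewrite mulrA ler_pdivrMr// mulrC ler_wpM2l ?ltW//.
by apply: le_lt_trans (ler_norm _) _; rewrite ltrDl.
Qed.

End Sums.

Lemma l2le_inj (R : realType) (T T' : choiceType) (f : T' -> T) (u : T -> R[i])
  (c : R) : injective f -> l2le u c -> l2le (u \o f) c.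
Proof.
move=> fi uc s us; have := uc (map f s); rewrite map_inj_uniq// => /(_ us).
by rewrite big_map.
Qed.

(** * Fourier multipliers on square-summable families *)

Section SumReindexing.
Variables (R : realType) (T : choiceType).
Local Notation C := R[i].

Lemma has_csum_reindex (f f' : T -> T) (g : T -> C) S :
  cancel f f' -> cancel f' f -> has_csum g S -> has_csum (g \o f) S.
Proof.
move=> fK f'K H e e0; have [s0 H0] := H e e0.
exists (map f' s0) => s us ss; have := H0 (map f s).
rewrite map_inj_uniq ?big_map; last exact: can_inj fK.
apply=> // x xs; apply/mapP; exists (f' x); last by rewrite f'K.
by apply: ss; apply: map_f.
Qed.

Lemma has_csum_sum (I : Type) (r : seq I) (F : I -> T -> C) (S : I -> C) :
  (forall i, has_csum (F i) (S i)) ->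
  has_csum (fun x => \sum_(i <- r) F i x) (\sum_(i <- r) S i).
Proof.
move=> H; elim: r => [|i r IH].
  have := @has_csum_finite R T [::] (fun=> 0) isT (fun _ _ => erefl).
  by rewrite !big_nil; congr has_csum; apply/funext => x; rewrite big_nil.
rewrite big_cons; have := has_csumD (H i) IH.
by congr has_csum; apply/funext => x; rewrite big_cons.
Qed.

Lemma csum_singleton (g : T -> C) a :
  (forall x, x != a -> g x = 0) -> csum g = g a.
Proof.
move=> g0; apply: (@has_csum_uniq _ _ g).
  apply: csumP; exists (Normc.normc (g a)) => s us.
  have [as_|as_] := boolP (a \in s).
    rewrite (bigD1_seq a)//= big1 ?addr0// => x xa.
    by rewrite g0// Normc.normc0.
  rewrite big_seq big1 ?normc_ge0// => x xs.
  by rewrite g0 ?Normc.normc0//; apply: contraNN as_ => /eqP <-.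
have -> : g a = \sum_(x <- [:: a]) g x by rewrite big_seq1.
by apply: has_csum_finite => // x; rewrite inE => /g0.
Qed.

End SumReindexing.

Section Multipliers.
Variables (R : realType) (d : nat).
Local Notation C := R[i].
Local Notation Z := 'rV[int]_d.
Local Notation tp := (@torus_pt R d).
Local Notation hat := (@hat R d).
Implicit Types (phi psi f g : 'rV[C]_d -> C) (th : nat -> R) (a b x y : Z).
Implicit Types (h k u v : Z -> C) (c : R).

Definition is_l2 h := exists c : R, l2le h c.

Definition multiplier phi h : Z -> C := fun x => csum (fun y => h (x - y) * hat phi y).

Lemma subK x : involutive (fun y => x - y).
Proof. by move=> y; rewrite opprB addrCA subrr addr0. Qed.

Lemma l2le_reflect x h c : l2le h c -> l2le (fun y => h (x - y)) c.
Proof. exact: l2le_inj (inv_inj (subK x)). Qed.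

Lemma l2le_hat phi : baire phi -> l2le (hat phi) (energy phi).
Proof. by move=> bphi s us; exact: bessel. Qed.

(** Cauchy-Schwarz combined with Bessel. This pointwise estimate is the continuity used by the
    approximation arguments in [multiplier_hat] and [multiplier_comp]. *)
Lemma multiplier_bound phi h c x : baire phi -> l2le h c ->
  cnorm2 (multiplier phi h x) <= c * energy phi.
Proof.
by move=> bphi hc; exact: csum_mul_le (l2le_reflect x hc) (l2le_hat bphi).
Qed.

Lemma multiplierD phi h k : baire phi -> is_l2 h -> is_l2 k ->
  multiplier phi (fun x => h x + k x) = fun x => multiplier phi h x + multiplier phi k x.
Proof.
move=> bphi [c hc] [c' kc]; apply/funext => x.
exact: csum_mulDl (l2le_reflect x hc) (l2le_reflect x kc) (l2le_hat bphi).
Qed.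

Lemma multiplierZ phi z h : baire phi -> is_l2 h ->
  multiplier phi (fun x => z * h x) = fun x => z * multiplier phi h x.
Proof.
move=> bphi [c hc]; apply/funext => x; rewrite /multiplier -csumZ.
  by congr csum; apply/funext => y; rewrite mulrA.
exact: abs_summable_mul (l2le_reflect x hc) (l2le_hat bphi).
Qed.

Lemma multiplier_symD phi psi h : baire phi -> baire psi -> is_l2 h ->
  multiplier (fun z => phi z + psi z) h =
  fun x => multiplier phi h x + multiplier psi h x.
Proof.
move=> bphi bpsi [c hc]; apply/funext => x; rewrite /multiplier.
transitivity (csum (fun y => (hat phi y + hat psi y) * h (x - y))).
  by congr csum; apply/funext => y; rewrite hatD// mulrC.
rewrite (csum_mulDl (l2le_hat bphi) (l2le_hat bpsi) (l2le_reflect x hc)).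
by rewrite /=; congr (_ + _); congr csum; apply/funext => y; rewrite mulrC.
Qed.

Lemma multiplier_symZ z phi h : baire phi -> is_l2 h ->
  multiplier (fun t => z * phi t) h = fun x => z * multiplier phi h x.
Proof.
move=> bphi [c hc]; apply/funext => x; rewrite /multiplier -csumZ.
  by congr csum; apply/funext => y; rewrite hatZ// mulrCA.
exact: abs_summable_mul (l2le_reflect x hc) (l2le_hat bphi).
Qed.

Lemma multiplier_ext phi psi h : (forall th, phi (tp th) = psi (tp th)) ->
  multiplier phi h = multiplier psi h.
Proof.
move=> e; apply/funext => x; congr csum; apply/funext => y.
by rewrite (hat_ext y e).
Qed.

Lemma multiplier_zpow a h : multiplier (fun z => zpow z a) h = fun x => h (x - a).
Proof.
apply/funext => x; rewrite /multiplier (csum_singleton (a := a)).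
  by rewrite hat_zpow eqxx mulr1.
by move=> y ya; rewrite hat_zpow (negbTE ya) mulr0.
Qed.

Lemma multiplier_delta phi a :
  multiplier phi (delta R a) = hat (fun z => phi z * zpow z a).
Proof.
apply/funext => x; rewrite hat_mul_zpow /multiplier (csum_singleton (a := x - a)).
  by rewrite subK /delta eqxx mul1r.
move=> y ya; rewrite /delta (_ : x - y == a = false) ?mul0r//.
by apply: contraNF ya => /eqP <-; rewrite subK.
Qed.

(* By Cauchy-Schwarz [|u|^2 = <h, v>] is at most [|h| |v|], where [v] is a
   Fourier transform of [phi] times a trigonometric polynomial of energy [|u|^2],
   so that Bessel's inequality bounds [|v|^2] by [B |u|^2]. *)
Lemma l2le_multiplier phi h c (B : R) : baire phi ->
  (forall th, cnorm2 (phi (tp th)) <= B) -> l2le h c ->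
  l2le (multiplier phi h) (B * c).
Proof.
move=> bphi phiB hc s us.
have B0 : 0 <= B by apply: le_trans (phiB (fun=> 0)); exact: cnorm2_ge0.
have c0 := l2le_ge0 hc.
set u := multiplier phi h; set S := \sum_(x <- s) _.
have S0 : 0 <= S by apply: sumr_ge0 => x _; exact: cnorm2_ge0.
(* The coefficient [conjc (u x)] sits at frequency [-x], so that the coefficient of [phi * p] at
   [-y] is the sum of the [conjc (u x) * hat phi (x - y)], which pairs with [h] to give [|u|^2] over
   [s]. *)
pose p (z : 'rV[C]_d) := \sum_(x <- map -%R s) conjc (u (- x)) * zpow z x.
have us' : uniq (map -%R s) by rewrite map_inj_uniq//; exact: oppr_inj.
have Ep : energy p = S.
  rewrite energy_trig// big_map; apply: eq_bigr => x _.
  by rewrite opprK cnorm2J.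
have bp : baire p by exact: baire_trig.
pose v y := hat (fun z => phi z * p z) (0 - y).
have vE y : v y = \sum_(x <- s) conjc (u x) * hat phi (x - y).
  rewrite /v /p; transitivity (hat (fun z => \sum_(x <- s)
      conjc (u x) * (phi z * zpow z (- x))) (0 - y)).
    apply: hat_ext => th; rewrite big_map mulr_sumr; apply: eq_bigr => x _.
    by rewrite opprK mulrCA.
  elim: s {us S S0 p us' Ep bp v} => [|x s IH].
    rewrite big_nil -[RHS](hat0 R (0 - y)).
    by apply: hat_ext => th; rewrite big_nil.
  rewrite big_cons -IH.
  have bx : baire (fun z => phi z * zpow z (- x)).
    by apply: baireM => //; exact: baire_zpow.
  transitivity (hat (fun z => conjc (u x) * (phi z * zpow z (- x)) +
      \sum_(x <- s) conjc (u x) * (phi z * zpow z (- x))) (0 - y)).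
    by apply: hat_ext => th; rewrite big_cons.
  rewrite hatD ?hatZ ?hat_mul_zpow//.
  - by congr (_ * hat phi _ + _); rewrite opprK sub0r addrC.
  - exact: baireZ.
  - apply: baire_sum => x'; apply: baireZ; apply: baireM => //; exact: baire_zpow.
have lv : l2le v (B * S).
  apply: l2le_reflect => t ut; apply: le_trans (bessel (baireM bphi bp) ut) _.
  by rewrite -Ep; exact: energy_mul_le.
have SE : csum (fun y => h y * v y) = S%:C%C.
  apply: has_csum_uniq (csumP (abs_summable_mul hc lv)) _.
  have H x : has_csum (fun y => conjc (u x) * (h y * hat phi (x - y)))
      (conjc (u x) * u x).
    apply: has_csumZ; rewrite /u /multiplier.
    have := has_csum_reindex (subK x) (subK x) (csumP (abs_summable_mul
      (l2le_reflect x hc) (l2le_hat bphi))).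
    by congr has_csum; apply/funext => y; rewrite /= subK.
  have := has_csum_sum s H.
  rewrite (_ : \sum_(x <- s) conjc (u x) * u x = S%:C%C); last first.
    by rewrite /S rmorph_sum /=; apply: eq_bigr => x _; rewrite mulrC mulcJE.
  congr has_csum; apply/funext => y; rewrite vE mulr_sumr.
  by apply: eq_bigr => x _; rewrite mulrCA.
(* This reads [S^2 <= c * (B * S)]; one factor [S] is cancelled, the case [S = 0] being trivial. *)
have := csum_mul_le hc lv; rewrite SE /cnorm2 /= expr0n addr0 expr2.
rewrite mulrA; have [S00|Sn0] := eqVneq S 0; first by rewrite S00 mulr_ge0.
by rewrite ler_pM2r ?lt_def ?Sn0// mulrC.
Qed.

Lemma is_l2_multiplier phi h : baire phi -> is_l2 h -> is_l2 (multiplier phi h).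
Proof.
move=> bphi [c hc]; have [B H] := baire_bounded bphi.
by exists (B * c); exact: l2le_multiplier.
Qed.

Lemma is_l2D h k : is_l2 h -> is_l2 k -> is_l2 (fun x => h x + k x).
Proof. by move=> [c hc] [c' kc]; eexists; apply: l2leD hc kc. Qed.

Lemma is_l2Z z h : is_l2 h -> is_l2 (fun x => z * h x).
Proof. by move=> [c hc]; eexists; apply: l2leZ hc. Qed.

Lemma is_l2_hat phi : baire phi -> is_l2 (hat phi).
Proof. by move=> bphi; eexists; exact: l2le_hat. Qed.

(* Parseval's identity, in convolution form. *)
Lemma multiplier_hat phi psi : baire phi -> baire psi ->
  multiplier phi (hat psi) = hat (fun z => phi z * psi z).
Proof.
move=> bphi; elim=> {psi} [a|f g bf IHf bg IHg|z f bf IHf|v f B bv IHv vB vf].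
- rewrite -multiplier_delta; congr multiplier; apply/funext => x.
  exact: hat_zpow.
- have -> : hat (fun z => f z + g z) = fun x => hat f x + hat g x.
    by apply/funext => x; rewrite hatD.
  rewrite multiplierD ?IHf ?IHg//; try exact: is_l2_hat.
  apply/funext => x; rewrite -hatD; [|exact: baireM..].
  by apply: hat_ext => th; rewrite mulrDr.
- have -> : hat (fun t => z * f t) = fun x => z * hat f x.
    by apply/funext => x; rewrite hatZ.
  rewrite multiplierZ ?IHf//; last exact: is_l2_hat.
  apply/funext => x; rewrite -hatZ; last exact: baireM.
  by apply: hat_ext => th; rewrite mulrCA.
- have bf : baire f by exact: baire_lim vB vf.
  apply/funext => x; apply/eqP; rewrite -subr_eq0 -cnorm2_eq0.
  rewrite eq_le cnorm2_ge0 andbT.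
  have [B' phiB] := baire_bounded bphi.
  set D := _ - _; pose E n := energy (fun z => v n z - f z).
  (* The identity holds for [v n], so up to sign the defect at [f] equals the defect at [v n - f].
     Its two terms are bounded by [multiplier_bound] and by Bessel's inequality for a single
     coefficient. *)
  have DE n : cnorm2 D <= 2 * (E n * energy phi + B' * E n).
    have bw : baire (fun z => v n z - f z) by exact: baireB.
    have -> : D = - (multiplier phi (hat (fun z => v n z - f z)) x -
        hat (fun z => phi z * (v n z - f z)) x).
      have -> : hat (fun z => v n z - f z) = fun x => hat (v n) x + (-1) * hat f x.
        by apply/funext => y; rewrite hatB// mulN1r.
      rewrite multiplierD ?multiplierZ ?IHv//; try exact: is_l2_hat; last first.
        by apply: is_l2Z; exact: is_l2_hat.
      have -> : hat (fun z => phi z * (v n z - f z)) x =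
          hat (fun z => phi z * v n z) x - hat (fun z => phi z * f z) x.
        rewrite -hatB; [|exact: baireM..].
        by apply: hat_ext => th; rewrite mulrBr.
      by rewrite /D; ring.
    rewrite cnorm2N; apply: le_trans (cnorm2D_le _ _) _; rewrite cnorm2N ler_pM2l//.
    rewrite lerD//; first by apply: multiplier_bound => //; exact: l2le_hat.
    apply: le_trans (energy_mul_le bphi bw phiB).
    have := bessel (s := [:: x]) (baireM bphi bw) isT.
    by rewrite big_seq1.
  have cE : 2 * (E n * energy phi + B' * E n) @[n --> \oo] --> (0 : R).
    rewrite [X in _ --> X](_ : 0 = 2 * (0 * energy phi + B' * 0)); last by ring.
    have E0 := energy_cvg0 bv bf vB vf.
    apply: cvgM; first exact: cvg_cst.
    by apply: cvgD; apply: cvgM => //; exact: cvg_cst.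
  by apply: (cvgr_to_ge cE); exact: nearW.
Qed.

(** At a fixed [x] the difference of the two sides is a bounded linear functional of [h], so it
    suffices to treat point masses, where the claim is [multiplier_hat]. *)
Lemma multiplier_comp phi psi h : baire phi -> baire psi -> is_l2 h ->
  multiplier phi (multiplier psi h) = multiplier (fun z => phi z * psi z) h.
Proof.
move=> bphi bpsi lh; apply/funext => x; apply/eqP; rewrite -subr_eq0; apply/eqP.
have bm : baire (fun z => phi z * psi z) by exact: baireM.
have [B psiB] := baire_bounded bpsi.
move: h lh; apply: (l2_functional0 (l := fun h => multiplier phi (multiplier psi h) x -
  multiplier (fun z => phi z * psi z) h x)
  (K := 2 * (B * energy phi + energy (fun z => phi z * psi z)))).
- move=> u v lu lv; rewrite !multiplierD//; try exact: is_l2_multiplier.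
  by ring.
- move=> z u lu; rewrite !multiplierZ//; try exact: is_l2_multiplier.
  by ring.
- move=> u c uc; apply: le_trans (cnorm2D_le _ _) _; rewrite -mulrA ler_pM2l//.
  rewrite cnorm2N mulrDl lerD//.
    by rewrite mulrAC; apply: multiplier_bound => //; exact: l2le_multiplier.
  by rewrite mulrC; exact: multiplier_bound.
- move=> a; rewrite !multiplier_delta multiplier_hat//; last first.
    by apply: baireM => //; exact: baire_zpow.
  apply/eqP; rewrite subr_eq0; apply/eqP; apply: hat_ext => th.
  by rewrite mulrA.
Qed.

(** Factors are removed one at a time. The factor [1 + z^a] acts as [k(x) + k(x - a)]; if this
    vanishes, [|k|] is constant along the progression [x - n a]. For [a] nonzero the progression is
    infinite, against square-summability; for [a = 0] the equation is [2 k = 0]. *)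
Lemma multiplier_prod_eq0 (S : seq Z) h : is_l2 h ->
  multiplier (fun z => \prod_(a <- S) (1 + zpow z a)) h = (fun=> 0) ->
  h = fun=> 0.
Proof.
have shift_sum0 a k : is_l2 k -> (forall x, k x + k (x - a) = 0) -> k = fun=> 0.
  move=> [c kc] ka; apply/funext => x; apply/eqP.
  have [a0|a0] := eqVneq a 0.
    have := ka x; rewrite a0 subr0 -mulr2n => /eqP; rewrite -mulr_natr mulf_eq0.
    by rewrite pnatr_eq0 orbF.
  have knE n : cnorm2 (k (x - a *+ n)) = cnorm2 (k x).
    elim: n => [|n IH]; first by rewrite mulr0n subr0.
    rewrite -IH mulrSr opprD addrA -[in RHS]cnorm2N; congr cnorm2.
    by apply/eqP; rewrite -addr_eq0 [_ + k _]addrC ka.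
  have inj : injective (fun n => x - a *+ n).
    move=> m n /addrI /oppr_inj.
    have [j aj] : exists j, a 0 j != 0.
      apply/existsP; apply: contraNT a0 => /existsPn H; apply/eqP/rowP => j.
      by rewrite mxE; apply/eqP; rewrite -[_ == _]negbK H.
    move=> /(congr1 (fun b : Z => b 0 j)); rewrite !mulmxnE.
    exact: (@mulrIn int (a 0 j) aj m n).
  have nk n : n%:R * cnorm2 (k x) <= c.
    have := kc [seq x - a *+ m | m <- iota 0 n].
    rewrite map_inj_uniq// iota_uniq => /(_ isT); apply: le_trans.
    rewrite big_map (eq_bigr (fun=> cnorm2 (k x))); last by move=> m _; exact: knE.
    by rewrite big_const_seq count_predT size_iota iter_addr_0 mulr_natl.
  rewrite -cnorm2_eq0 eq_le cnorm2_ge0 andbT leNgt; apply/negP => k0.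
  (* This number of points exceeds [c / |k x|^2], so their total mass would exceed [c]. *)
  have := nk (Num.trunc (c / cnorm2 (k x))).+1.
  apply/negP; rewrite -ltNge -ltr_pdivrMr//.
  exact: truncnS_gt.
elim: S h => [|a S IH] h lh.
  rewrite (multiplier_ext (psi := fun z => zpow z 0)) ?multiplier_zpow => [H|th].
    by apply/funext => x; have := congr1 (@^~ x) H; rewrite subr0.
  by rewrite big_nil zpow0.
have ba := baire_one_add_zpow R a.
have bS : baire (fun z : 'rV[C]_d => \prod_(a <- S) (1 + zpow z a)).
  by apply: baire_prod => b; exact: baire_one_add_zpow.
rewrite (multiplier_ext (psi := fun z => (1 + zpow z a) * \prod_(a <- S) (1 + zpow z a)));
  last by move=> th; rewrite big_cons.
rewrite -multiplier_comp// => H; apply: IH => //.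
have lk : is_l2 (multiplier (fun z => \prod_(a <- S) (1 + zpow z a)) h).
  exact: is_l2_multiplier.
apply: (shift_sum0 a) => // x; have := congr1 (@^~ x) H.
rewrite (multiplier_ext (psi := fun z => zpow z 0 + zpow z a)); last first.
  by move=> th; rewrite zpow0.
by rewrite multiplier_symD ?multiplier_zpow ?subr0//; exact: baire_zpow.
Qed.

End Multipliers.

(** * Normalization of vector symbols by polynomial approximation of the inverse square root *)

Section Normalization.
Variables (R : realType) (d : nat).
Local Notation C := R[i].
Local Notation tp := (@torus_pt R d).

(* Newton's iteration for [y^(-1/2)]: each iterate is a polynomial in [y], and
   [newton_rsqrt c y k * sqrt y] increases to 1 when [0 < c * sqrt y <= 1]. *)
Fixpoint newton_rsqrt (c y : R) (k : nat) : R :=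
  if k is k'.+1 then
    newton_rsqrt c y k' * (3 - y * newton_rsqrt c y k' ^+ 2) / 2
  else c.

(** The rescaled iterates obey [x -> x (3 - x^2) / 2], and [1 - x (3 - x^2) / 2 = (1 - x) (1 - x/2 -
    x^2/2)]. The last factor is at most [1 - x/2], hence at most 1 minus half the starting value, as
    [x] never falls below that value. *)
Lemma newton_rsqrtP (c y : R) k : 0 <= y -> 0 <= c -> c * Num.sqrt y <= 1 ->
  let x k := newton_rsqrt c y k * Num.sqrt y in
  [/\ c * Num.sqrt y <= x k, x k <= 1 &
      1 - x k <= (1 - c * Num.sqrt y / 2) ^+ k].
Proof.
move=> y0 c0; set s := Num.sqrt y => cs1 x.
have s0 : 0 <= s by exact: sqrtr_ge0.
have cs0 : 0 <= c * s by exact: mulr_ge0.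
have xS n : x n.+1 = x n * (3 - x n ^+ 2) / 2.
  by rewrite /x /= exprMn [s ^+ 2]sqr_sqrtr//; field.
elim: k => [|k [IH1 IH2 IH3]].
  by rewrite expr0; split; rewrite ?lexx// lerBlDr lerDl.
have xk0 : 0 <= x k by exact: le_trans IH1.
have xk1 : 0 <= 1 - x k by rewrite subr_ge0.
have x1 : 0 <= x k * (1 - x k) * (1 + x k).
  exact: mulr_ge0 (mulr_ge0 xk0 xk1) (addr_ge0 ler01 xk0).
have x2 : 0 <= (1 - x k) * (2 + x k).
  exact: mulr_ge0 xk1 (addr_ge0 (ler0n _ 2) xk0).
have x3 := mulr_ge0 xk1 x2.
rewrite xS; split.
- by apply: le_trans IH1 _; rewrite expr2; lra.
- by rewrite expr2; lra.
- rewrite [_ ^+ k.+1]exprS [X in X <= _](_ : _ = (1 - x k / 2 - x k ^+ 2 / 2) * (1 - x k));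
    last by field.
  apply: ler_pM => //; rewrite ?subr_ge0//.
    by rewrite expr2; lra.
  by have := sqr_ge0 (x k); lra.
Qed.

Lemma cvg_newton_rsqrt (c y : R) : 0 < y -> 0 < c -> c * Num.sqrt y <= 1 ->
  (newton_rsqrt c y k * Num.sqrt y - 1) ^+ 2 @[k --> \oo] --> (0 : R).
Proof.
move=> y0 c0 cs1; set q := 1 - c * Num.sqrt y / 2.
have cs0 : 0 < c * Num.sqrt y by rewrite mulr_gt0// sqrtr_gt0.
have q1 : `|q| < 1 by rewrite /q ltr_norml; apply/andP; split; lra.
apply: (squeeze_cvgr (f := fun=> 0) (h := fun k => q ^+ k)).
- apply: nearW => k; rewrite sqr_ge0 /=.
  have [h1 h2] := newton_rsqrtP k (ltW y0) (ltW c0) cs1.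
  rewrite -/q => h3; apply: le_trans h3.
  set x := newton_rsqrt c y k * Num.sqrt y in h1 h2 *.
  have x0 : 0 < x by exact: lt_le_trans h1.
  by rewrite expr2; nra.
- exact: cvg_cst.
- exact: cvg_expr.
Qed.

(* Where [u] vanishes, the junk value [0^-1 = 0] makes the normalized vector 0. *)
Lemma baire_normalize (D : nat) (u : 'I_D -> 'rV[C]_d -> C) :
  (forall i, baire (u i)) -> forall i, baire (fun z =>
    ((Num.sqrt (\sum_(j < D) cnorm2 (u j z)))^-1)%:C%C * u i z).
Proof.
move=> bu i; set y := fun z => \sum_(j < D) cnorm2 (u j z).
have y0 z : 0 <= y z by apply: sumr_ge0 => j _; exact: cnorm2_ge0.
have uy z j : cnorm2 (u j z) <= y z.
  rewrite /y (bigD1 j)//= lerDl; apply: sumr_ge0 => l _; exact: cnorm2_ge0.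
have bY : baire (fun z => (y z)%:C%C).
  apply: baire_ext (baire_sum (index_enum 'I_D) predT (fun j => baire_cnorm2 (bu j))) => th.
  by rewrite rmorph_sum.
have [B HB] := baire_bounded bY.
have B0 : 0 <= B by apply: le_trans (HB (fun=> 0)); exact: cnorm2_ge0.
(* [HB] gives [y^2 <= B] on the torus, hence [sqrt y <= B + 2]: one starting value works at all
   points simultaneously. *)
pose c := (B + 2)^-1.
have c0 : 0 < c by rewrite invr_gt0; lra.
have cs1 th : c * Num.sqrt (y (tp th)) <= 1.
  rewrite mulrC ler_pdivrMr ?mul1r; last by lra.
  have := HB th; rewrite {1}/cnorm2 /= expr0n addr0 => yB.
  have := sqrtr_ge0 (y (tp th)); set s := Num.sqrt _ => s0.
  have : s ^+ 2 <= B + 1.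
    rewrite sqr_sqrtr//; have := sqr_ge0 (y (tp th) - 1).
    move: yB (y0 (tp th)); move: (y _) => t; rewrite !expr2; nra.
  by rewrite expr2; nra.
pose v k z := (newton_rsqrt c (y z) k)%:C%C * u i z.
have br k : baire (fun z => (newton_rsqrt c (y z) k)%:C%C).
  elim: k => [|k IH]; first exact: (baire_cst d c%:C%C).
  apply: baire_ext (baireM IH (baireZ (2^-1)%:C%C (baireB (baire_cst d (3%:R)%:C%C)
    (baireM bY (baireM IH IH))))) => th /=.
  by rewrite -!rmorphM -rmorphB -!rmorphM /=; congr (_%:C%C); rewrite expr2; field.
have v_eq k th : cnorm2 (v k (tp th)) = newton_rsqrt c (y (tp th)) k ^+ 2 * cnorm2 (u i (tp th)).
  by rewrite cnorm2M {1}/cnorm2 /= expr0n addr0.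
apply: (baire_lim (u := v) (B := 1)).
- by move=> k; exact: baireM.
- move=> k th; rewrite v_eq.
  apply: le_trans (_ : newton_rsqrt c (y (tp th)) k ^+ 2 * y (tp th) <= _).
    by rewrite ler_wpM2l// sqr_ge0.
  rewrite -[X in _ * X]sqr_sqrtr// -exprMn.
  have [h1 h2 _] := newton_rsqrtP k (y0 (tp th)) (ltW c0) (cs1 th).
  rewrite expr_le1//; apply: le_trans h1; rewrite mulr_ge0 ?sqrtr_ge0//.
  exact: ltW.
- move=> th; have [yy|yn] := eqVneq (y (tp th)) 0.
    have u0 : u i (tp th) = 0.
      by apply/eqP; rewrite -cnorm2_eq0 eq_le cnorm2_ge0 andbT -yy.
    rewrite (_ : (fun k => _) = fun=> 0); first exact: cvg_cst.
    by apply/funext => k; rewrite /v u0 !mulr0 subrr cnorm20.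
  have yp : 0 < y (tp th) by rewrite lt_def yn y0.
  (* Since [|u i|^2 <= y], the squared error is at most the square of
     [newton_rsqrt * sqrt y - 1]. *)
  apply: (squeeze_cvgr (f := fun=> 0) _ (cvg_cst _) (cvg_newton_rsqrt yp c0 (cs1 th))).
  apply: nearW => k; rewrite cnorm2_ge0 /=.
  rewrite -mulrBl -rmorphB cnorm2M {1}/cnorm2 /= expr0n addr0.
  set s := Num.sqrt _; have s0 : s != 0 by rewrite gt_eqF// sqrtr_gt0.
  have -> : newton_rsqrt c (y (tp th)) k * s - 1 =
      (newton_rsqrt c (y (tp th)) k - s^-1) * s by field.
  rewrite exprMn sqr_sqrtr; last exact: (y0 (tp th)).
  by apply: ler_wpM2l; [exact: sqr_ge0|exact: uy].
Qed.

End Normalization.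

(** * Matrix-valued symbols acting on vector-valued families *)

Section MatrixMultipliers.
Variables (R : realType) (d : nat).
Local Notation C := R[i].
Local Notation Z := 'rV[int]_d.
Local Notation tp := (@torus_pt R d).

Definition is_l2v n (g : Z -> 'cV[C]_n) := forall j, is_l2 (fun x => g x j 0).

Definition baire_mx m n (F : 'rV[C]_d -> 'M[C]_(m, n)) :=
  forall i j, baire (fun z => F z i j).

(** Rectangular symbols are allowed, so that the column [w_o] and the row [w_o^*] act between scalar
    and vector families. *)
Definition mxmult m n (F : 'rV[C]_d -> 'M[C]_(m, n)) (g : Z -> 'cV[C]_n) :
    Z -> 'cV[C]_m :=
  fun x => \col_i \sum_(j < n) multiplier (fun z => F z i j) (fun y => g y j 0) x.

Lemma is_l2_0 : is_l2 (fun _ : Z => 0 : C).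
Proof.
by exists 0 => s _; rewrite big1// => x _; rewrite cnorm20.
Qed.

Lemma is_l2_sum n (h : 'I_n -> Z -> C) : (forall j, is_l2 (h j)) ->
  is_l2 (fun x => \sum_(j < n) h j x).
Proof.
move=> H; elim: (index_enum _) => [|j r IH].
  by rewrite (_ : (fun x => _) = fun=> 0); [exact: is_l2_0|apply/funext => x; rewrite big_nil].
rewrite (_ : (fun x => _) = fun x => h j x + \sum_(j <- r) h j x).
  exact: is_l2D.
by apply/funext => x; rewrite big_cons.
Qed.

Lemma multiplier0 (phi : 'rV[C]_d -> C) : baire phi ->
  multiplier phi (fun=> 0) = fun=> 0.
Proof.
move=> bphi; have := multiplierZ 0 bphi is_l2_0.
rewrite (_ : (fun x : Z => 0 * _) = fun=> 0); last by apply/funext => x; rewrite mul0r.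
by move=> ->; apply/funext => x; rewrite mul0r.
Qed.

Lemma multiplier_sym0 (h : Z -> C) : is_l2 h ->
  multiplier (fun _ : 'rV[C]_d => 0) h = fun=> 0.
Proof.
move=> lh; have := multiplier_symZ 0 (baire_cst d (0 : C)) lh.
rewrite (multiplier_ext (psi := fun=> 0)); last by move=> th; rewrite mul0r.
by move=> ->; apply/funext => x; rewrite mul0r.
Qed.

Lemma multiplier_sum (phi : 'rV[C]_d -> C) (I : Type) (r : seq I) (h : I -> Z -> C) :
  baire phi -> (forall i, is_l2 (h i)) ->
  multiplier phi (fun x => \sum_(i <- r) h i x) =
  fun x => \sum_(i <- r) multiplier phi (h i) x.
Proof.
move=> bphi lh.
suff [] : is_l2 (fun x => \sum_(i <- r) h i x) /\
    multiplier phi (fun x => \sum_(i <- r) h i x) =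
    fun x => \sum_(i <- r) multiplier phi (h i) x by [].
elim: r => [|i r [IH1 IH2]].
  have E (k : I -> Z -> C) : (fun x => \sum_(i <- [::]) k i x) = fun=> 0.
    by apply/funext => x; rewrite big_nil.
  by rewrite !E multiplier0//; split => //; exact: is_l2_0.
have E (k : I -> Z -> C) : (fun x => \sum_(i <- i :: r) k i x) =
    fun x => k i x + \sum_(i <- r) k i x.
  by apply/funext => x; rewrite big_cons.
by rewrite !E multiplierD// IH2; split => //; exact: is_l2D.
Qed.

Lemma multiplier_sym_sum (I : Type) (r : seq I) (F : I -> 'rV[C]_d -> C) (h : Z -> C) :
  (forall i, baire (F i)) -> is_l2 h ->
  multiplier (fun z => \sum_(i <- r) F i z) h =
  fun x => \sum_(i <- r) multiplier (F i) h x.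
Proof.
move=> bF lh; elim: r => [|i r IH].
  rewrite (multiplier_ext (psi := fun=> 0)) ?multiplier_sym0// => [|th].
    by apply/funext => x; rewrite big_nil.
  by rewrite big_nil.
rewrite (multiplier_ext (psi := fun z => F i z + \sum_(i <- r) F i z)); last first.
  by move=> th; rewrite big_cons.
rewrite multiplier_symD// ?IH; last exact: baire_sum.
by apply/funext => x; rewrite big_cons.
Qed.

Lemma is_l2v_mxmult m n (F : 'rV[C]_d -> 'M[C]_(m, n)) g :
  baire_mx F -> is_l2v g -> is_l2v (mxmult F g).
Proof.
move=> bF lg i; rewrite (_ : (fun x => _) = fun x =>
    \sum_(j < n) multiplier (fun z => F z i j) (fun y => g y j 0) x).
  by apply: is_l2_sum => j; exact: is_l2_multiplier.
by apply/funext => x; rewrite mxE.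
Qed.

Lemma mxmult_ext m n (F G : 'rV[C]_d -> 'M[C]_(m, n)) g :
  (forall th, F (tp th) = G (tp th)) -> mxmult F g = mxmult G g.
Proof.
move=> FG; apply/funext => x; apply/colP => i; rewrite !mxE.
apply: eq_bigr => j _; congr (_ x); apply: multiplier_ext => th.
by rewrite FG.
Qed.

Lemma mxmult_comp m n p (F : 'rV[C]_d -> 'M[C]_(m, n))
    (G : 'rV[C]_d -> 'M[C]_(n, p)) g :
  baire_mx F -> baire_mx G -> is_l2v g ->
  mxmult F (mxmult G g) = mxmult (fun z => F z *m G z) g.
Proof.
move=> bF bG lg; apply/funext => x; apply/colP => i; rewrite !mxE.
transitivity (\sum_(k < n) \sum_(j < p)
    multiplier (fun z => F z i k * G z k j) (fun y => g y j 0) x).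
  apply: eq_bigr => k _.
  rewrite (_ : (fun y => mxmult G g y k 0) = fun y =>
      \sum_(j < p) multiplier (fun z => G z k j) (fun y => g y j 0) y); last first.
    by apply/funext => y; rewrite mxE.
  rewrite multiplier_sum//; last by move=> j; exact: is_l2_multiplier.
  by apply: eq_bigr => j _; rewrite multiplier_comp.
rewrite exchange_big /=; apply: eq_bigr => j _.
rewrite (multiplier_ext (psi := fun z => \sum_(k < n) F z i k * G z k j)).
  by rewrite multiplier_sym_sum// => k; exact: baireM.
by move=> th; rewrite mxE.
Qed.

Lemma mxmultD m n (F G : 'rV[C]_d -> 'M[C]_(m, n)) g :
  baire_mx F -> baire_mx G -> is_l2v g ->
  mxmult (fun z => F z + G z) g = fun x => mxmult F g x + mxmult G g x.
Proof.
move=> bF bG lg; apply/funext => x; apply/colP => i; rewrite !mxE -big_split /=.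
apply: eq_bigr => j _.
rewrite (multiplier_ext (psi := fun z => F z i j + G z i j)).
  by rewrite multiplier_symD.
by move=> th; rewrite mxE.
Qed.

Lemma mxmultN m n (F : 'rV[C]_d -> 'M[C]_(m, n)) g :
  baire_mx F -> is_l2v g -> mxmult (fun z => - F z) g = fun x => - mxmult F g x.
Proof.
move=> bF lg; apply/funext => x; apply/colP => i; rewrite !mxE -sumrN.
apply: eq_bigr => j _.
rewrite (multiplier_ext (psi := fun z => -1 * F z i j)).
  by rewrite multiplier_symZ// mulN1r.
by move=> th; rewrite mxE mulN1r.
Qed.

Lemma mxmult_scalar n (phi : 'rV[C]_d -> C) (g : Z -> 'cV[C]_n) i x :
  baire phi -> is_l2v g ->
  mxmult (fun z => (phi z)%:M) g x i 0 = multiplier phi (fun y => g y i 0) x.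
Proof.
move=> bphi lg; rewrite mxE (bigD1 i)//= big1 ?addr0.
  by congr (_ x); apply: multiplier_ext => th; rewrite mxE eqxx.
move=> j ji; rewrite (multiplier_ext (psi := fun=> 0)) ?multiplier_sym0// => th.
by rewrite mxE eq_sym (negbTE ji).
Qed.

Lemma mxmult1 n (g : Z -> 'cV[C]_n) : is_l2v g -> mxmult (fun=> 1%:M) g = g.
Proof.
move=> lg; apply/funext => x; apply/colP => i.
rewrite (mxmult_scalar (phi := fun=> 1)) ?(multiplier_ext (psi := fun z => zpow z 0))//.
- by rewrite multiplier_zpow subr0.
- by move=> th; rewrite zpow0.
- exact: baire_cst.
Qed.

Lemma baire_mxM m n p (F : 'rV[C]_d -> 'M[C]_(m, n)) (G : 'rV[C]_d -> 'M[C]_(n, p)) :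
  baire_mx F -> baire_mx G -> baire_mx (fun z => F z *m G z).
Proof.
move=> bF bG i j; apply: baire_ext (baire_sum (index_enum 'I_n) predT
  (fun k => baireM (bF i k) (bG k j))) => th.
by rewrite mxE.
Qed.

Lemma baire_mx_cst m n (A : 'M[C]_(m, n)) : baire_mx (fun=> A).
Proof. by move=> i j; exact: baire_cst. Qed.

Lemma baire_mxB m n (F G : 'rV[C]_d -> 'M[C]_(m, n)) :
  baire_mx F -> baire_mx G -> baire_mx (fun z => F z - G z).
Proof.
move=> bF bG i j; apply: baire_ext (baireB (bF i j) (bG i j)) => th.
by rewrite !mxE.
Qed.

Lemma baire_mxZ m n (phi : 'rV[C]_d -> C) (F : 'rV[C]_d -> 'M[C]_(m, n)) :
  baire phi -> baire_mx F -> baire_mx (fun z => phi z *: F z).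
Proof.
move=> bphi bF i j; apply: baire_ext (baireM bphi (bF i j)) => th.
by rewrite !mxE.
Qed.

Lemma baire_mx_sum m n (I : Type) (r : seq I) (F : I -> 'rV[C]_d -> 'M[C]_(m, n)) :
  (forall a, baire_mx (F a)) -> baire_mx (fun z => \sum_(a <- r) F a z).
Proof.
move=> bF i j; apply: baire_ext (baire_sum r predT (fun a => bF a i j)) => th.
by rewrite summxE.
Qed.

Lemma baire_mx_ext m n (F G : 'rV[C]_d -> 'M[C]_(m, n)) :
  (forall th, F (tp th) = G (tp th)) -> baire_mx F -> baire_mx G.
Proof. by move=> FG bF i j; apply: baire_ext (bF i j) => th; rewrite FG. Qed.

Lemma is_l2P (h : Z -> C) : is_l2 h <-> l2s h.
Proof.
split=> [[c hc]|lh].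
  apply: le_lt_trans (ltry c); apply: esum_le_seq => s us.
  by rewrite lee_fin hc.
exists (fine (\esum_(x in [set: Z]) (cnorm2 (h x))%:E)%E) => s us.
rewrite -lee_fin fineK; first exact: esum_seq_le.
rewrite ge0_fin_numE//; apply: esum_ge0 => x _.
by rewrite lee_fin cnorm2_ge0.
Qed.

Lemma is_l2vP n (g : Z -> 'cV[C]_n) : is_l2v g <-> l2v g.
Proof.
split=> [lg|lg j].
  have [c Hc] := boolp.choice lg.
  apply: le_lt_trans (ltry (\sum_(j < n) c j)); apply: esum_le_seq => s us.
  rewrite lee_fin exchange_big /=; apply: ler_sum => j _; exact: Hc.
apply/is_l2P; apply: le_lt_trans lg; apply: le_esum => x _.
rewrite lee_fin /vnorm2 (bigD1 j)//= lerDl sumr_ge0// => i _.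
exact: cnorm2_ge0.
Qed.

End MatrixMultipliers.

(** * The walk operator *)

Section Walk.
Variables (R : realType) (d D : nat).
Local Notation C := R[i].
Local Notation Z := 'rV[int]_d.
Local Notation tp := (@torus_pt R d).
Implicit Types (S : seq Z) (P : Z -> 'M[C]_D) (mu v : 'cV[C]_D) (z : 'rV[C]_d).

(** Rectangular form of [adjoint], needed for [mu] and [w_o]; on square matrices the two are
    convertible. *)
Definition ctr m n (A : 'M[C]_(m, n)) : 'M[C]_(n, m) := (map_mx conjc A)^T.

Definition coin mu : 'M[C]_D := 2 *: (mu *m ctr mu) - 1%:M.

Definition shift S P z : 'M[C]_D := \sum_(a <- S) zpow z a *: P a.

Definition denom S z : C := \prod_(a <- S) (1 + zpow z a).

(** For [S] without repetitions and [a] in [S] this is [Q / (1 + z^a)] with [Q = denom S z], in a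
    form meaningful on [E] too. *)
Definition codenom S a z : C := \prod_(b <- S | b != a) (1 + zpow z b).

(** The vector [mu - eta mu] multiplied by [Q] to clear denominators, see [numerE]; a trigonometric
    polynomial defined everywhere. *)
Definition numer S P mu z : 'cV[C]_D :=
  \sum_(a <- S) (2 * zpow z a * codenom S a z) *: (P a *m mu).

Lemma cinnerE (u v : 'cV[C]_D) : ctr v *m u = (cinner u v)%:M.
Proof.
apply/matrixP => i j; rewrite !ord1 !mxE eqxx; apply: eq_bigr => k _.
by rewrite !mxE mulrC.
Qed.

Lemma cinner_self (u : 'cV[C]_D) : cinner u u = (vnorm2 u)%:C%C.
Proof. by rewrite rmorph_sum; apply: eq_bigr => i _; rewrite mulcJE. Qed.

Lemma CmuE mu v : Cmu mu v = coin mu *m v.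
Proof.
rewrite /Cmu /coin mulmxBl mul1mx -scalemxAl -mulmxA cinnerE.
by rewrite mul_mx_scalar scalerA.
Qed.

Lemma vnorm2_ge0 (v : 'cV[C]_D) : 0 <= vnorm2 v.
Proof. by apply: sumr_ge0 => i _; exact: cnorm2_ge0. Qed.

Lemma vnorm2_eq0 (v : 'cV[C]_D) : (vnorm2 v == 0) = (v == 0).
Proof.
apply/idP/eqP => [|->]; last by rewrite /vnorm2 big1// => i _; rewrite mxE cnorm20.
rewrite psumr_eq0 => [/allP H|i _]; last exact: cnorm2_ge0.
apply/colP => i; rewrite mxE; apply/eqP; rewrite -cnorm2_eq0.
exact: H (mem_index_enum i).
Qed.

Lemma vnorm2Z (c : C) v : vnorm2 (c *: v) = cnorm2 c * vnorm2 v.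
Proof. by rewrite /vnorm2 mulr_sumr; apply: eq_bigr => i _; rewrite mxE cnorm2M. Qed.

Lemma denomE S a z : uniq S -> a \in S ->
  denom S z = (1 + zpow z a) * codenom S a z.
Proof. by move=> uS aS; rewrite /denom (bigD1_seq a). Qed.

Lemma denom_eq0 S z : (denom S z == 0) = in_E S z.
Proof.
rewrite /denom /in_E; elim: S => [|a S IH]; first by rewrite big_nil oner_eq0.
by rewrite big_cons mulf_eq0 IH /= addrC addr_eq0.
Qed.

Lemma resolution_projE S P a (mu : 'cV[C]_D) (f : Z -> C) :
  resolution_of_unity S P -> uniq S -> a \in S ->
  P a *m \sum_(b <- S) f b *: (P b *m mu) = f a *: (P a *m mu).
Proof.
move=> [PP P0 _] uS aS; rewrite mulmx_sumr (bigD1_seq a)//=.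
rewrite -scalemxAr mulmxA (PP a aS).2 big_seq_cond big1 ?addr0// => b /andP[bS ba].
by rewrite -scalemxAr mulmxA P0 ?mul0mx ?scaler0// eq_sym.
Qed.

Lemma one_add_zpow_neq0 S z a : ~~ in_E S z -> a \in S -> 1 + zpow z a != 0.
Proof.
move=> /hasPn H aS; rewrite addrC addr_eq0; exact: H.
Qed.

(** Write [mu] as the sum of the [P a mu] and use [1 - (1 - w) / (1 + w) = 2 w / (1 + w)]. *)
Lemma eta_residueE S P mu z : resolution_of_unity S P -> ~~ in_E S z ->
  mu - eta_op S P z *m mu =
  \sum_(a <- S) (2 * zpow z a / (1 + zpow z a)) *: (P a *m mu).
Proof.
move=> [_ _ P1] zE; rewrite -{1}[mu]mul1mx -P1 !mulmx_suml -sumrB.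
rewrite !big_seq; apply: eq_bigr => a aS; rewrite -scalemxAl -{1}[_ *m _]scale1r -scalerBl.
by congr (_ *: _); have := one_add_zpow_neq0 zE aS => h; field.
Qed.

Lemma numerE S P mu z : uniq S -> resolution_of_unity S P -> ~~ in_E S z ->
  numer S P mu z = denom S z *: (mu - eta_op S P z *m mu).
Proof.
move=> uS rP zE; rewrite eta_residueE// scaler_sumr /numer !big_seq.
apply: eq_bigr => a aS; rewrite scalerA; congr (_ *: _).
by rewrite (denomE _ uS aS); have := one_add_zpow_neq0 zE aS => h; field.
Qed.

(* Multiplying by [conj Q] also takes care of [E], where both sides are 0. *)
Lemma wo_normalized S P mu z : uniq S -> resolution_of_unity S P ->
  let u := conjc (denom S z) *: numer S P mu z in
  wo S P mu z = ((Num.sqrt (vnorm2 u))^-1)%:C%C *: u.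
Proof.
move=> uS rP u; rewrite /wo; case: ifPn => zE.
  have /eqP Q0 : denom S z == 0 by rewrite denom_eq0.
  by rewrite /u Q0 conjc0 scale0r scaler0.
rewrite {}/u numerE//; set v := mu - _; set Q := denom S z.
have Q0 : cnorm2 Q != 0 by rewrite cnorm2_eq0 denom_eq0.
rewrite scalerA [conjc Q * Q]mulrC mulcJE vnorm2Z scalerA.
have -> : cnorm2 (cnorm2 Q)%:C%C = cnorm2 Q ^+ 2 by rewrite {1}/cnorm2 /= expr0n addr0.
rewrite sqrtrM ?sqr_ge0// sqrtr_sqr ger0_norm ?cnorm2_ge0// -rmorphM /=.
congr (_ *: _); rewrite -[Complex _ 0]/((vnorm v)^-1)%:C%C; congr (_%:C%C).
by rewrite /vnorm invfM mulrAC mulVf// mul1r.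
Qed.

Lemma baire_codenom S a : baire (fun z : 'rV[C]_d => codenom S a z).
Proof. by apply: baire_prod => b; exact: baire_one_add_zpow. Qed.

Lemma baire_denom S : baire (fun z : 'rV[C]_d => denom S z).
Proof. by apply: baire_prod => b; exact: baire_one_add_zpow. Qed.

(** By [wo_normalized], [w_o] is the normalization of a vector of trigonometric polynomials, on [E]
    as well as off it. *)
Lemma baire_wo S P mu : uniq S -> resolution_of_unity S P ->
  baire_mx (fun z => wo S P mu z).
Proof.
move=> uS rP i j; rewrite ord1.
have bu k : baire (fun z => (conjc (denom S z) *: numer S P mu z) k 0).
  apply: (baire_mx_ext (F := fun z => conjc (denom S z) *: numer S P mu z)) => //.
  apply: baire_mxZ; first by apply: baireJ; exact: baire_denom.
  apply: baire_mx_sum => a; apply: baire_mxZ; last exact: baire_mx_cst.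
  apply: baireM; last exact: baire_codenom.
  by apply: baireZ; exact: baire_zpow.
apply: baire_ext (baire_normalize bu i) => th.
by rewrite wo_normalized// !mxE.
Qed.

Lemma cinner_sum (I : Type) (r : seq I) (c : I -> C) (F : I -> 'cV[C]_D) v :
  cinner (\sum_(a <- r) c a *: F a) v = \sum_(a <- r) c a * cinner (F a) v.
Proof.
rewrite /cinner; under [RHS]eq_bigr do rewrite mulr_sumr.
rewrite exchange_big /=; apply: eq_bigr => i _.
rewrite summxE mulr_suml; apply: eq_bigr => a _.
by rewrite mxE mulrA.
Qed.

Lemma cinner_proj (A : 'M[C]_D) mu : adjoint A = A -> A *m A = A ->
  cinner (A *m mu) mu = (vnorm2 (A *m mu))%:C%C.
Proof.
move=> Aa AA; apply/eqP; rewrite -cinner_self; apply/eqP.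
suff : (cinner (A *m mu) mu)%:M = (cinner (A *m mu) (A *m mu))%:M :> 'M[C]_(1, 1).
  by move=> /matrixP /(_ 0 0); rewrite !mxE eqxx.
rewrite -!cinnerE /ctr map_mxM trmx_mul -/(ctr mu) -/(adjoint A) Aa.
by rewrite -mulmxA [A *m (A *m mu)]mulmxA AA.
Qed.

(* The coefficient [(1 - z^a) / (1 + z^a)] of [eta] is odd in [a] while
   [|P a mu|^2] is even, so that [<eta mu, mu> = 0]. *)
Lemma cinner_eta_residue S P mu th :
  uniq S -> (forall a, a \in S -> - a \in S) -> resolution_of_unity S P ->
  vnorm mu = 1 ->
  (forall a, a \in S -> vnorm (P a *m mu) = vnorm (P (- a) *m mu)) ->
  ~~ in_E S (tp th) ->
  cinner (mu - eta_op S P (tp th) *m mu) mu = 1.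
Proof.
move=> uS Ssym rP mu1 Psym zE; have [PP _ _] := rP.
pose n a : C := (vnorm2 (P a *m mu))%:C%C.
pose c a := (1 - zpow (tp th) a) / (1 + zpow (tp th) a).
have -> : mu - eta_op S P (tp th) *m mu =
    1 *: mu + (-1) *: \sum_(a <- S) c a *: (P a *m mu).
  rewrite scale1r scaleN1r mulmx_suml; congr (_ - _).
  by apply: eq_bigr => a _; rewrite scalemxAl.
have mumu : cinner mu mu = 1.
  rewrite cinner_self -[vnorm2 mu]sqr_sqrtr ?vnorm2_ge0// -/(vnorm mu) mu1.
  by rewrite expr1n.
(* Linearity for a combination of two vectors, stated as a sum over a list of pairs of a coefficient
   and a vector. *)
have := cinner_sum [:: (1 : C, mu); (-1, \sum_(a <- S) c a *: (P a *m mu))]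
  (fun p => p.1) (fun p => p.2) mu.
rewrite !big_cons !big_nil !addr0 /= => ->.
rewrite mumu cinner_sum mul1r mulN1r.
suff -> : \sum_(a <- S) c a * cinner (P a *m mu) mu = 0 by rewrite subr0.
have -> : \sum_(a <- S) c a * cinner (P a *m mu) mu = \sum_(a <- S) c a * n a.
  rewrite !big_seq; apply: eq_bigr => a aS; have [h1 h2] := PP a aS.
  by rewrite cinner_proj.
set X := \sum_(a <- S) _.
have XN : X = - X.
  rewrite {1}/X (perm_big (map -%R S)) /=; last first.
    apply: uniq_perm => //; first by rewrite map_inj_uniq//; exact: oppr_inj.
    move=> a; apply/idP/mapP => [aS|[b bS ->]]; last exact: Ssym.
    by exists (- a); [exact: Ssym|rewrite opprK].
  rewrite big_map -sumrN !big_seq; apply: eq_bigr => a aS.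
  rewrite -mulNr; congr (_ * _); last first.
    have vE (v : 'cV[C]_D) : vnorm2 v = vnorm v ^+ 2.
      by rewrite sqr_sqrtr ?vnorm2_ge0.
    by rewrite /n !vE -Psym.
  (* With [w = z^a] and [w'] its conjugate, the oddness [(1 - w') / (1 + w') = - (1 - w) / (1 + w)]
     comes down to [w w' = 1]. *)
  rewrite /c zpowN; have := one_add_zpow_neq0 zE aS.
  have := one_add_zpow_neq0 zE (Ssym a aS); rewrite zpowN.
  have := mulcJE (zpow (tp th) a); rewrite cnorm2_zpow.
  move: (zpow _ _) (conjc _) => w w' ww' h' h.
  apply/eqP; rewrite -mulNr eqr_div//; apply/eqP.
  transitivity (w - w' + (1 - w * w')); first by ring.
  by rewrite [RHS](_ : _ = w - w' - (1 - w * w')); [rewrite ww'; ring|ring].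
have : X *+ 2 == 0 by rewrite mulr2n {1}XN addNr.
by rewrite -mulr_natr mulf_eq0 pnatr_eq0 orbF => /eqP.
Qed.

(** What has to be excluded is [mu - eta mu = 0], and this vector has inner product 1 with [mu]. *)
Lemma wo_unit S P mu th :
  uniq S -> (forall a, a \in S -> - a \in S) -> resolution_of_unity S P ->
  vnorm mu = 1 ->
  (forall a, a \in S -> vnorm (P a *m mu) = vnorm (P (- a) *m mu)) ->
  ~~ in_E S (tp th) ->
  ctr (wo S P mu (tp th)) *m wo S P mu (tp th) = 1%:M.
Proof.
move=> uS Ssym rP mu1 Psym zE; rewrite cinnerE cinner_self /wo (negbTE zE) vnorm2Z.
set v := mu - _.
have v0 : vnorm2 v != 0.
  rewrite vnorm2_eq0; apply/eqP => v0.
  have := cinner_eta_residue uS Ssym rP mu1 Psym zE; rewrite -/v v0.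
  by move/eqP; rewrite /cinner big1 ?(eq_sym 0) ?oner_eq0// => i _; rewrite mxE mul0r.
congr (_%:M); rewrite /cnorm2 /= expr0n addr0 exprVn sqr_sqrtr ?vnorm2_ge0//.
by rewrite mulVf.
Qed.

(** For [v = mu - eta mu] one has [<v, mu> = 1], so [C v = 2 mu - v]; along [P a mu] the claim is
    [w (2 - 2 w / (1 + w)) = 2 w / (1 + w)] with [w = z^a]. On [E] both sides are 0. *)
Lemma wo_fixed S P mu th :
  uniq S -> (forall a, a \in S -> - a \in S) -> resolution_of_unity S P ->
  vnorm mu = 1 ->
  (forall a, a \in S -> vnorm (P a *m mu) = vnorm (P (- a) *m mu)) ->
  shift S P (tp th) *m coin mu *m wo S P mu (tp th) = wo S P mu (tp th).
Proof.
move=> uS Ssym rP mu1 Psym; rewrite /wo; case: ifPn => zE; first by rewrite mulmx0.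
set v := mu - _; rewrite -scalemxAr; congr (_ *: _).
rewrite -mulmxA -CmuE /Cmu (cinner_eta_residue uS Ssym rP mu1 Psym zE) mulr1.
rewrite /shift mulmx_suml {2}/v eta_residueE// !big_seq; apply: eq_bigr => a aS.
rewrite mulmxBr -scalemxAl -scalemxAr {1}/v eta_residueE//.
rewrite -scalemxAl resolution_projE// !scalerA -scalerBl.
by congr (_ *: _); have := one_add_zpow_neq0 zE aS => h; field.
Qed.

Lemma proj_shift S P a z : resolution_of_unity S P -> uniq S -> a \in S ->
  P a *m shift S P z = zpow z a *: P a.
Proof.
move=> [PP P0 _] uS aS; rewrite mulmx_sumr (bigD1_seq a)//=.
rewrite -scalemxAr (PP a aS).2 big_seq_cond big1 ?addr0// => b /andP[bS ba].
by rewrite -scalemxAr P0 ?scaler0// eq_sym.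
Qed.

Definition codenom_mx S P z : 'M[C]_D := \sum_(a <- S) codenom S a z *: P a.

(** Write [A] for [codenom_mx] and [W] for [shift]. From [P a W = z^a P a] follow [A + A W = Q] and
    [2 A W mu = numer]; expanding the coin as [2 mu mu^* - 1] gives the identity. *)
Lemma codenom_mx_eigen S P mu z : uniq S -> resolution_of_unity S P ->
  codenom_mx S P z *m (1%:M - shift S P z *m coin mu) =
  denom S z *: 1%:M - numer S P mu z *m ctr mu.
Proof.
move=> uS rP; have [_ _ P1] := rP.
rewrite mulmxBr mulmx1 mulmxA.
have -> : codenom_mx S P z *m shift S P z =
    \sum_(a <- S) (codenom S a z * zpow z a) *: P a.
  rewrite /codenom_mx mulmx_suml !big_seq; apply: eq_bigr => a aS.
  by rewrite -scalemxAl proj_shift// scalerA.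
rewrite /coin mulmxBr mulmx1 -P1 scaler_sumr opprB addrA /numer !mulmx_suml.
congr (_ - _).
  rewrite /codenom_mx -big_split !big_seq; apply: eq_bigr => a aS /=.
  by rewrite -scalerDl; congr (_ *: _); rewrite (denomE _ uS aS); ring.
apply: eq_bigr => a _; rewrite -!scalemxAl -scalemxAr mulmxA scalerA.
by congr (_ *: _); ring.
Qed.

Lemma range_projection_factor S P mu th :
  uniq S -> (forall a, a \in S -> - a \in S) -> resolution_of_unity S P ->
  vnorm mu = 1 ->
  (forall a, a \in S -> vnorm (P a *m mu) = vnorm (P (- a) *m mu)) ->
  let z := tp th in
  let W := wo S P mu z in
  (denom S z ^+ 2) *: (1%:M - W *m ctr W) =
  denom S z *: (1%:M - W *m ctr W) *m codenom_mx S P z *m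
    (1%:M - shift S P z *m coin mu).
Proof.
move=> uS Ssym rP mu1 Psym z W.
rewrite -mulmxA codenom_mx_eigen// mulmxBr mulmxA -scalemxAr mulmx1 scalerA.
suff -> : denom S z *: (1%:M - W *m ctr W) *m numer S P mu z = 0.
  by rewrite mul0mx subr0 expr2.
have [zE|zE] := boolP (in_E S z).
  have /eqP -> : denom S z == 0 by rewrite denom_eq0.
  by rewrite scale0r mul0mx.
rewrite numerE//; set v := mu - _.
have vW : v = (vnorm v)%:C%C *: W.
  rewrite /W /wo (negbTE zE) -/v -[Complex _ 0]/((vnorm v)^-1)%:C%C scalerA.
  rewrite -rmorphM /= divff ?scale1r//.
  apply/eqP => v0; have : vnorm2 v = 0.
    by rewrite -[LHS]sqr_sqrtr ?vnorm2_ge0// -/(vnorm v) v0 expr0n.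
  move=> /eqP; rewrite vnorm2_eq0 => /eqP {}v0.
  have := cinner_eta_residue uS Ssym rP mu1 Psym zE; rewrite -/v v0.
  by move/eqP; rewrite /cinner big1 ?(eq_sym 0) ?oner_eq0// => i _; rewrite mxE mul0r.
rewrite vW -scalemxAl -!scalemxAr mulmxBl mul1mx -mulmxA.
by rewrite (wo_unit uS Ssym rP mu1 Psym zE) mulmx1 subrr !scaler0.
Qed.

Lemma baire_shift_coin S P mu : baire_mx (fun z => shift S P z *m coin mu).
Proof.
apply: baire_mxM; last exact: baire_mx_cst.
apply: baire_mx_sum => a; apply: baire_mxZ; last exact: baire_mx_cst.
exact: baire_zpow.
Qed.

Lemma UopE S P mu (g : Z -> 'cV[C]_D) : is_l2v g ->
  Uop S P (Cmu mu) g = mxmult (fun z => shift S P z *m coin mu) g.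
Proof.
move=> lg; apply/funext => x; apply/colP => i; rewrite mxE summxE.
transitivity (\sum_(a <- S) \sum_(j < D) (P a *m coin mu) i j * g (x - a) j 0).
  by apply: eq_bigr => a _; rewrite CmuE mulmxA mxE.
rewrite exchange_big /=; apply: eq_bigr => j _.
rewrite (multiplier_ext (psi := fun z => \sum_(a <- S)
    (P a *m coin mu) i j * zpow z a)); last first.
  move=> th; rewrite /shift mulmx_suml summxE; apply: eq_bigr => a _.
  by rewrite -scalemxAl mxE mulrC.
rewrite multiplier_sym_sum//; last by move=> a; apply: baireZ; exact: baire_zpow.
apply: eq_bigr => a _; rewrite multiplier_symZ//; last exact: baire_zpow.
by rewrite multiplier_zpow.
Qed.

(** A matter of unfolding: the entries of [invFourier w] are the [hat] of the entries of [w], and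
    [f] is read as a family of vectors with one entry. *)
Lemma convolution_invFourierE (f : Z -> C) (w : 'rV[C]_d -> 'cV[C]_D) :
  convolution f (invFourier w) = mxmult w (fun x => \col_(i < 1) f x).
Proof.
apply/funext => x; apply/colP => i; rewrite !mxE big_ord1.
congr csum; apply/funext => y; rewrite !mxE; congr (_ * _).
Qed.

End Walk.

Theorem theorem3p3 (R : realType) (d D : nat) (S : seq 'rV[int]_d)
    (P : 'rV[int]_d -> 'M[R[i]]_D) (mu : 'cV[R[i]]_D) :
  uniq S ->
  (forall a, a \in S -> - a \in S) ->
  resolution_of_unity S P ->
  vnorm mu = 1 ->
  (forall a, a \in S -> vnorm (P a *m mu) = vnorm (P (- a) *m mu)) ->
  forall g : 'rV[int]_d -> 'cV[R[i]]_D,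
    (l2v g /\ Uop S P (Cmu mu) g = g) <->
    (exists f : 'rV[int]_d -> R[i], l2s f /\ g = convolution f (invFourier (wo S P mu))).
Proof.
move=> uS Ssym rP mu1 Psym g.
set W := wo S P mu.
have bW : baire_mx W := baire_wo mu uS rP.
have bU := baire_shift_coin S P mu.
split=> [[/is_l2vP lg Ug]|[f [/is_l2P lf ->]]]; last first.
  (* Convolutions with [w] are fixed by the walk, because its symbol fixes [w_o(z)] at every point
     of the torus. *)
  rewrite convolution_invFourierE.
  set F := fun x => _.
  have lF : is_l2v F.
    by move=> j; rewrite (_ : (fun x => _) = f)//; apply/funext => x; rewrite mxE.
  split; first by apply/is_l2vP; exact: is_l2v_mxmult.
  rewrite UopE ?mxmult_comp//; last exact: is_l2v_mxmult.
  by apply: mxmult_ext => th; exact: wo_fixed.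
have bWJ : baire_mx (fun z => ctr (W z)).
  move=> i j; apply: baire_ext (baireJ (bW j i)) => th.
  by rewrite !mxE.
have bWW : baire_mx (fun z => W z *m ctr (W z)) by exact: baire_mxM.
have b1 : baire_mx (fun _ : 'rV[R[i]]_d => 1%:M : 'M[R[i]]_D) by exact: baire_mx_cst.
pose X z := 1%:M - W z *m ctr (W z).
have bX : baire_mx X by exact: baire_mxB.
have bQ : baire (fun z : 'rV[R[i]]_d => denom S z) := baire_denom R S.
(* The witness: the coordinate of [g] along [w_o]. Multiplying it by [w_o] again gives the
   projection of [g], and [X] measures what is lost. *)
pose F := mxmult (fun z => ctr (W z)) g.
have lF : is_l2v F by exact: is_l2v_mxmult.
exists (fun x => F x 0 0); split; first by apply/is_l2P; exact: lF.
rewrite convolution_invFourierE.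
have -> : (fun x => \col_(i < 1) F x 0 0) = F.
  by apply/funext => x; apply/colP => i; rewrite mxE !ord1.
have lX : is_l2v (mxmult X g) by exact: is_l2v_mxmult.
have XgE x : mxmult X g x = g x - mxmult W F x.
  rewrite mxmult_comp// (mxmultD b1 (G := fun z => - (W z *m ctr (W z))))//; last first.
    move=> i j; apply: baire_ext (baireZ (-1) (bWW i j)) => th.
    by rewrite [RHS]mxE mulN1r.
  by rewrite mxmultN// mxmult1.
(* The symbol [Q^2 X] factors with [1 - shift * coin] on the right, and that factor annihilates the
   eigenvector [g]. *)
have QX0 : mxmult (fun z => (denom S z ^+ 2)%:M) (mxmult X g) = fun=> 0.
  have bQ2 : baire_mx (fun z : 'rV[R[i]]_d => (denom S z ^+ 2)%:M : 'M[R[i]]_D).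
    apply: (baire_mx_ext (F := fun z => (denom S z * denom S z) *: 1%:M)).
      by move=> th; rewrite scalemx1 expr2.
    by apply: baire_mxZ => //; exact: baireM.
  have bUX : baire_mx (fun z => 1%:M - shift S P z *m coin mu) by exact: baire_mxB.
  have bL : baire_mx (fun z => denom S z *: X z *m codenom_mx S P z).
    apply: baire_mxM; first exact: baire_mxZ.
    by apply: baire_mx_sum => a; apply: baire_mxZ; [exact: baire_codenom|exact: baire_mx_cst].
  rewrite mxmult_comp//.
  rewrite (mxmult_ext (G := fun z => (denom S z *: X z *m codenom_mx S P z) *m
    (1%:M - shift S P z *m coin mu))); last first.
    move=> th; rewrite mul_scalar_mx; exact: range_projection_factor.
  rewrite -mxmult_comp//.
  have -> : mxmult (fun z => 1%:M - shift S P z *m coin mu) g = fun=> 0.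
    rewrite (mxmultD b1 (G := fun z => - (shift S P z *m coin mu)))//; last first.
      move=> i j; apply: baire_ext (baireZ (-1) (bU i j)) => th.
      by rewrite [RHS]mxE mulN1r.
    rewrite mxmultN// mxmult1// -UopE// Ug; apply/funext => x; exact: subrr.
  apply/funext => x; apply/colP => i; rewrite !mxE big1// => j _.
  rewrite (_ : (fun y : 'rV[int]_d => _) = fun=> 0); first by rewrite multiplier0.
  by apply/funext => y; rewrite mxE.
apply/funext => x; apply/eqP; rewrite -subr_eq0 -XgE; apply/eqP/colP => i.
rewrite [RHS]mxE.
suff /(congr1 (@^~ x)) : (fun y => mxmult X g y i 0) = fun=> 0 by [].
(* [Q^2] is the product of the [1 + z^a] over [S ++ S], so the injectivity result removes both
   copies of [Q] at once. *)
apply: (multiplier_prod_eq0 (S := S ++ S)) => //.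
rewrite (multiplier_ext (psi := fun z => denom S z ^+ 2)); last first.
  by move=> th; rewrite big_cat expr2.
apply/funext => y; rewrite -mxmult_scalar ?QX0 ?mxE//.
by rewrite (_ : (fun z => _) = fun z => denom S z * denom S z)//; exact: baireM.
Qed.
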